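(* Let $(M_1,g_1)$ and $(M_2,g_2)$ be Riemannian manifolds with $m_2=\dim M_2\ge 2$, let $\lambda$ be a smooth positive function on $M_1$, and let $\overline M=M_1\times_\lambda M_2$ be the warped product manifold with metric $\bar g=g_1\oplus\lambda^2 g_2$. Let $(X_1,X_2),(Y_1,Y_2),(Z_1,Z_2),(W_1,W_2)$ be vector fields on $\overline M$. Then: (i) The $(0,4)$-type Riemannian curvature tensor $\overline{\mathrm{Rm}}$ of $\bar g$ satisfies $$\begin{aligned} &\overline{\mathrm{Rm}}\big((W_1,W_2),(Z_1,Z_2),(X_1,X_2),(Y_1,Y_2)\big)\\ &={}^{M_1}\mathrm{Rm}(W_1,Z_1,X_1,Y_1)+\lambda^2\,{}^{M_2}\mathrm{Rm}(W_2,Z_2,X_2,Y_2)\\ &\quad+\lambda\,\mathrm{Hess}(\lambda)(Y_1,W_1)\,g_2(X_2,Z_2)-\lambda\,\mathrm{Hess}(\lambda)(X_1,W_1)\,g_2(Y_2,Z_2)\\ &\quad+\lambda\,\mathrm{Hess}(\lambda)(X_1,Z_1)\,g_2(W_2,Y_2)-\lambda\,\mathrm{Hess}(\lambda)(Y_1,Z_1)\,g_2(W_2,X_2)\\ &\quad+\lambda^2|\mathrm{grad}\,\lambda|^2 g_2(X_2,Z_2)g_2(W_2,Y_2)-\lambda^2|\mathrm{grad}\,\lambda|^2 g_2(Y_2,Z_2)g_2(W_2,X_2). \end{aligned}$$ (ii) The Ricci curvature tensor $\overline{\mathrm{Ric}}$ of $\bar g$ satisfies $$\begin{aligned} \overline{\mathrm{Ric}}\big((X_1,X_2),(Y_1,Y_2)\big)&={}^{M_1}\mathrm{Ric}(X_1,Y_1)+{}^{M_2}\mathrm{Ric}(X_2,Y_2)-\lambda\,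 g_2(X_2,Y_2)\,\Delta_{M_1}\lambda\\ &\quad-\frac{m_2}{\lambda}\mathrm{Hess}(\lambda)(X_1,Y_1)-(m_2-1)|\mathrm{grad}\,\lambda|^2 g_2(X_2,Y_2). \end{aligned}$$ (iii) The scalar curvature $\overline{\mathrm{Scal}}$ of $\bar g$ is $$\overline{\mathrm{Scal}}={}^{M_1}\mathrm{Scal}+\frac{1}{\lambda^2}\,{}^{M_2}\mathrm{Scal}-\frac{2m_2}{\lambda}\Delta_{M_1}\lambda-\frac{m_2(m_2-1)}{\lambda^2}|\mathrm{grad}\,\lambda|^2.$$
   Context: The warped product $M_1\times_\lambda M_2$ is the manifold $M_1\times M_2$ with the metric $\bar g(X,Y)=g_1(d\pi_1X,d\pi_1Y)+\lambda^2 g_2(d\pi_2X,d\pi_2Y)$, where $\pi_1,\pi_2$ are the projections onto $M_1$, $M_2$ and $\lambda$ is regarded as a function on $M_1\times M_2$ via $\pi_1$. A vector field on $\overline M$ is written $(X_1,X_2)$ according to the splitting $T\overline M=TM_1\oplus TM_2$; $(X_1,0)$ and $(0,X_2)$ denote the lifts of $X_1$ and $X_2$. ${}^{M_i}\mathrm{Rm}$, ${}^{M_i}\mathrm{Ric}$, ${}^{M_i}\mathrm{Scal}$ are the curvature tensors of $(M_i,g_i)$ (pulled back to $\overline M$). $\mathrm{grad}\,\lambda$, $|\mathrm{grad}\,\lambda|$, $\mathrm{Hess}(\lambda)(X_1,Y_1)=g_1({}^{M_1}\nabla_{X_1}\mathrm{grad}\,\lambda,Y_1)$ and $\Delta_{M_1}\lambda=\mathrm{Tr}_{g_1}\mathrm{Hess}(\lambda)$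 are taken on $(M_1,g_1)$. Curvature conventions: for a metric $g$ with Levi-Civita connection $\nabla$, $R_{XY}Z=\nabla_X\nabla_YZ-\nabla_Y\nabla_XZ-\nabla_{[X,Y]}Z$, $\mathrm{Rm}(W,Z,X,Y)=g(W,R_{XY}Z)$, $\mathrm{Ric}(X,Y)=\sum_i\mathrm{Rm}(e_i,X,e_i,Y)$ for an orthonormal frame $\{e_i\}$, and $\mathrm{Scal}$ is the trace of $\mathrm{Ric}$. *)

(* Defs.v *)
From HB Require Import structures.
From mathcomp Require Import all_boot all_order all_algebra.
From mathcomp Require Import all_classical all_reals all_analysis.
Import Order.TTheory GRing.Theory Num.Theory.
Import numFieldNormedType.Exports.

Set Implicit Arguments.
Unset Strict Implicit.
Unset Printing Implicit Defensive.

Local Open Scope classical_set_scope.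
Local Open Scope ring_scope.

(* C^k on an open set U *)
Fixpoint Ck (R : realType) (V W : normedModType R) (k : nat) (U : set V)
    (f : V -> W) : Prop :=
  if k is k'.+1 then
    (forall x, U x -> differentiable f x) /\
    (forall v, Ck k' U (fun x => 'D_v f x))
  else forall x, U x -> {for x, continuous f}.

Definition smooth_on (R : realType) (V W : normedModType R) (U : set V)
  (f : V -> W) : Prop := forall k, Ck k U f.

(* cmap is meaningful on cdom only, and its inverse cinv on cmap @` cdom only *)
Record chart (R : realType) (M : topologicalType) (m : nat) := Chart {
  cdom : set M;
  cmap :> M -> 'rV[R]_m;
  cinv : 'rV[R]_m -> M }.

Record is_chart (R : realType) (M : topologicalType) (m : nat)
    (c : chart R M m) : Prop := IsChart {
  cdom_open : open (cdom c);
  cimg_open : open (c @` cdom c);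
  cmapK : forall p, cdom c p -> cinv c (c p) = p;
  cmap_cont : forall p, cdom c p -> {for p, continuous c};
  cinv_cont : forall x, (c @` cdom c) x -> {for x, continuous (cinv c)} }.

(* chart_at is an arbitrary choice of a chart around each point; it serves to
   represent the tangent space at p by 'rV[R]_m. *)
Record manifold (R : realType) (m : nat) := Manifold {
  mspace :> topologicalType;
  atlas : set (chart R mspace m);
  chart_at : mspace -> chart R mspace m;
  manifold_hausdorff : hausdorff_space mspace;
  manifold_countable : @second_countable mspace;
  atlas_chart : forall c, atlas c -> is_chart c;
  atlas_smooth : forall c c', atlas c -> atlas c' ->
    smooth_on (c @` (cdom c `&` cdom c')) (c' \o cinv c);
  chart_at_atlas : forall p, atlas (chart_at p);
  chart_at_dom : forall p, cdom (chart_at p) p }.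


Section product_manifold.
Context (R : realType).

Lemma continuous_row_mx (a b : nat) :
  continuous (fun u : 'rV[R]_a * 'rV[R]_b => row_mx u.1 u.2).
Proof.
move=> u A /nbhs_ballP[e /= e0 eA]; apply/nbhs_ballP; exists e => //= w.
move=> [w1 w2]; apply: eA; split => // i j.
case: (splitP j) => k jk.
  have -> : j = lshift b k by exact/val_inj.
  by rewrite !row_mxEl; case: w1.
have -> : j = rshift a k by exact/val_inj.
by rewrite !row_mxEr; case: w2.
Qed.

Lemma diff_row_mx (a b : nat) (u : 'rV[R]_a * 'rV[R]_b) :
  is_diff u (fun u : 'rV[R]_a * 'rV[R]_b => row_mx u.1 u.2)
            (fun u => row_mx u.1 u.2).
Proof.
have lin : linear (fun u : 'rV[R]_a * 'rV[R]_b => row_mx u.1 u.2).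
  by move=> k x y; rewrite scale_row_mx add_row_mx.
pose linM := GRing.isLinear.Build _ _ _ _ _ lin.
pose L : {linear _ -> _} :=
  HB.pack (fun u : 'rV[R]_a * 'rV[R]_b => row_mx u.1 u.2) linM.
have -> : (fun u : 'rV[R]_a * 'rV[R]_b => row_mx u.1 u.2) = L by [].
apply: DiffDef; first exact/linear_differentiable/continuous_row_mx.
by rewrite diff_lin //; exact: continuous_row_mx.
Qed.

Definition row_fun (a b c d : nat) (f : 'rV[R]_a -> 'rV[R]_c)
  (g : 'rV[R]_b -> 'rV[R]_d) : 'rV[R]_(a + b) -> 'rV[R]_(c + d) :=
  fun x => row_mx (f (lsubmx x)) (g (rsubmx x)).

Lemma diff_row_fun (a b c d : nat) (f : 'rV[R]_a -> 'rV[R]_c)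
    (g : 'rV[R]_b -> 'rV[R]_d) (x : 'rV[R]_(a + b)) :
    differentiable f (lsubmx x) -> differentiable g (rsubmx x) ->
  is_diff x (row_fun f g)
    (row_fun ('d f (lsubmx x)) ('d g (rsubmx x))).
Proof.
move=> df dg.
have dl : is_diff x (lsubmx : 'rV[R]_(a + b) -> _) lsubmx.
  apply: DiffDef; first exact: differentiable_lsubmx.
  by rewrite diff_lin //; exact: continuous_lsubmx.
have dr : is_diff x (rsubmx : 'rV[R]_(a + b) -> _) rsubmx.
  apply: DiffDef; first exact: differentiable_rsubmx.
  by rewrite diff_lin //; exact: continuous_rsubmx.
have df' : is_diff (lsubmx x) f ('d f (lsubmx x)) by exact: DiffDef.
have dg' : is_diff (rsubmx x) g ('d g (rsubmx x)) by exact: DiffDef.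
have dfl := is_diff_comp dl df'; have dgr := is_diff_comp dr dg'.
exact: (is_diff_comp (is_diff_pair dfl dgr) (diff_row_mx _)).
Qed.

Lemma Ck_ext (V W : normedModType R) (k : nat) (U : set V) (f g : V -> W) :
  open U -> (forall x, U x -> f x = g x) -> Ck k U f -> Ck k U g.
Proof.
move=> oU; have nearU x : U x -> \forall y \near x, U y.
  by move=> Ux; exact: open_nbhs_nbhs.
elim: k f g => [|k IH] f g fg /=.
  move=> cf x Ux; have := cf x Ux.
  rewrite /prop_for /continuous_at -(fg x Ux).
  apply: cvg_trans; apply: near_eq_cvg.
  by near=> y; apply/fg; near: y; exact: nearU.
move=> [df Df]; split=> [x Ux|v].
  have [cdf /eqaddoP fo] := (diff_locallyP _ _).1 (df x Ux).
  have nU : \forall h \near (0 : V), U (h + x).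
    have : \forall y \near x, U y by exact: nearU.
    by rewrite (near_shift 0) subr0.
  have E : g \o shift x = cst (g x) + 'd f x +o_ 0 id.
    apply/eqaddoP => e e0; near=> h.
    have Uh : U (h + x) by near: h.
    have : `|(f \o shift x - (cst (f x) + 'd f x)) h| <= e * `|id h|.
      by near: h; exact: fo.
    by rewrite !fctE /= (fg _ Uh) (fg _ Ux).
  by apply/diff_locallyP; rewrite (diff_unique cdf E).
apply: IH (Df v) => x Ux; apply: near_eq_derive.
by near=> y; apply: fg; near: y; exact: nearU.
Unshelve. all: by end_near. Qed.

Lemma Ck_row_fun (a b c d k : nat) (U : set 'rV[R]_a) (V : set 'rV[R]_b)
    (f : 'rV[R]_a -> 'rV[R]_c) (g : 'rV[R]_b -> 'rV[R]_d) :
    open U -> open V -> Ck k U f -> Ck k V g ->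
  Ck k [set x | U (lsubmx x) /\ V (rsubmx x)] (row_fun f g).
Proof.
move=> oU oV.
have oUV : open [set x : 'rV[R]_(a + b) | U (lsubmx x) /\ V (rsubmx x)].
  apply: openI; first by move/continuousP: (@continuous_lsubmx R 1 a b); apply.
  by move/continuousP: (@continuous_rsubmx R 1 a b); apply.
elim: k f g => [|k IH] f g /=.
  move=> cf cg x [/= Ux Vx].
  have cl : {for x, continuous (f \o lsubmx)}.
    by apply: continuous_comp; [exact: continuous_lsubmx|exact: cf].
  have cr : {for x, continuous (g \o rsubmx)}.
    by apply: continuous_comp; [exact: continuous_rsubmx|exact: cg].
  apply: (@continuous_comp _ _ _ (fun x => (f (lsubmx x), g (rsubmx x)))
    (fun u => row_mx u.1 u.2)); last exact: continuous_row_mx.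
  exact: cvg_pair cl cr.
move=> [df Df] [dg Dg]; split=> [x [/= Ux Vx]|v].
  by have [] := diff_row_fun (df _ Ux) (dg _ Vx).
apply: Ck_ext (IH _ _ (Df (lsubmx v)) (Dg (rsubmx v))) => // x [/= Ux Vx].
have [dF eF] := diff_row_fun (df _ Ux) (dg _ Vx).
by rewrite deriveE // eF /row_fun deriveE ?deriveE //; [exact: dg|exact: df].
Qed.


Lemma open_chart_image (M : topologicalType) (m : nat) (c : chart R M m)
  (U : set M) : is_chart c -> open U -> open (c @` (cdom c `&` U)).
Proof.
move=> [oD oI cK _ ci] oU; rewrite openE => _ [p [Dp Up] <-].
have Ip : (c @` cdom c) (c p) by exists p.
have nI : nbhs (c p) (c @` cdom c) by exact: open_nbhs_nbhs.
have nU : nbhs (c p) (cinv c @^-1` U).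
  by apply: (ci _ Ip); rewrite cK //; exact: open_nbhs_nbhs.
apply: filterS (filterI nI nU) => _ [[q Dq <-] /=].
by rewrite cK // => Uq; exists q.
Qed.

Definition prod_chart (M1 M2 : topologicalType) (m1 m2 : nat)
    (c1 : chart R M1 m1) (c2 : chart R M2 m2) :
    chart R (M1 * M2)%type (m1 + m2) :=
  Chart (cdom c1 `*` cdom c2) (fun x => row_mx (c1 x.1) (c2 x.2))
        (fun v => (cinv c1 (lsubmx v), cinv c2 (rsubmx v))).

Lemma prod_chart_image (M1 M2 : topologicalType) (m1 m2 : nat)
    (c1 : chart R M1 m1) (c2 : chart R M2 m2) (A : set M1) (B : set M2) :
  prod_chart c1 c2 @` (A `*` B) =
  [set v | (c1 @` A) (lsubmx v) /\ (c2 @` B) (rsubmx v)].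
Proof.
apply/seteqP; split=> [_ [[p q] [/= Ap Bq] <-]|v [/= [p Ap pv] [q Bq qv]]].
  by rewrite /= row_mxKl row_mxKr; split; [exists p|exists q].
by exists (p, q) => //=; rewrite pv qv hsubmxK.
Qed.

Lemma open_row_set (a b : nat) (U : set 'rV[R]_a) (V : set 'rV[R]_b) :
  open U -> open V ->
  open [set x : 'rV[R]_(a + b) | U (lsubmx x) /\ V (rsubmx x)].
Proof.
move=> oU oV; apply: openI.
  by move/continuousP: (@continuous_lsubmx R 1 a b); apply.
by move/continuousP: (@continuous_rsubmx R 1 a b); apply.
Qed.

Lemma open_setX (M1 M2 : topologicalType) (A : set M1) (B : set M2) :
  open A -> open B -> open (A `*` B).
Proof.
by move=> oA oB; rewrite openE => -[p q] [/= Ap Bq]; exists (A, B) => //;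
  split; exact: open_nbhs_nbhs.
Qed.

Lemma prod_chartP (M1 M2 : topologicalType) (m1 m2 : nat)
    (c1 : chart R M1 m1) (c2 : chart R M2 m2) :
  is_chart c1 -> is_chart c2 -> is_chart (prod_chart c1 c2).
Proof.
move=> [oD1 oI1 K1 m1c i1c] [oD2 oI2 K2 m2c i2c]; split.
- exact: open_setX.
- by rewrite prod_chart_image; exact: open_row_set.
- by move=> [p q] [/= Dp Dq]; rewrite row_mxKl row_mxKr K1 ?K2.
- move=> [p q] [/= Dp Dq].
  have cl : {for (p, q), continuous ((c1 : M1 -> _) \o (@fst M1 M2))}.
    by apply: continuous_comp; [exact: cvg_fst|exact: m1c].
  have cr : {for (p, q), continuous ((c2 : M2 -> _) \o (@snd M1 M2))}.
    by apply: continuous_comp; [exact: cvg_snd|exact: m2c].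
  apply: (@continuous_comp _ _ _ (fun x => (c1 x.1, c2 x.2))
    (fun u => row_mx u.1 u.2)); last exact: continuous_row_mx.
  exact: cvg_pair cl cr.
- move=> x; rewrite prod_chart_image => -[/= Ix Jx].
  have cl : {for x, continuous (cinv c1 \o lsubmx)}.
    by apply: continuous_comp; [exact: continuous_lsubmx|exact: i1c].
  have cr : {for x, continuous (cinv c2 \o rsubmx)}.
    by apply: continuous_comp; [exact: continuous_rsubmx|exact: i2c].
  exact: cvg_pair cl cr.
Qed.

Lemma hausdorff_prod (M1 M2 : topologicalType) :
  hausdorff_space M1 -> hausdorff_space M2 -> hausdorff_space (M1 * M2)%type.
Proof.
move=> h1 h2 [p q] [p' q'] cl; congr (_, _).
  apply: h1 => A B nA nB.
  have [] := cl (A `*` setT) (B `*` setT).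
  - by exists (A, setT) => //; split=> //; exact: filterT.
  - by exists (B, setT) => //; split=> //; exact: filterT.
  by move=> [a b] [[/= Aa _] [/= Ba _]]; exists a.
apply: h2 => A B nA nB.
have [] := cl (setT `*` A) (setT `*` B).
- by exists (setT, A) => //; split=> //; exact: filterT.
- by exists (setT, B) => //; split=> //; exact: filterT.
by move=> [a b] [[/= _ Ab] [/= _ Bb]]; exists b.
Qed.

Lemma second_countable_prod (M1 M2 : topologicalType) :
  @second_countable M1 -> @second_countable M2 ->
  @second_countable (M1 * M2)%type.
Proof.
move=> [B1 cB1 [oB1 bB1]] [B2 cB2 [oB2 bB2]].
exists [set A `*` B | A in B1 & B in B2].
  have -> : [set A `*` B | A in B1 & B in B2] =
      \bigcup_(A in B1) ((fun B => A `*` B) @` B2).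
    apply/seteqP; split=> [_ [A ? [B ? <-]]|_ [A ? [B ? <-]]];
      by exists A => //; exists B.
  apply: bigcup_countable => // A _.
  exact: sub_countable (card_image_le _ _) cB2.
split=> [_ [A BA [B BB <-]]|[p q] U [[A B] [/= nA nB] ABU]].
  by apply: open_setX; [exact: oB1|exact: oB2].
have [A' [BA' A'p] A'A] := bB1 _ _ nA; have [B' [BB' B'q] B'B] := bB2 _ _ nB.
exists (A' `*` B'); first by split=> //; exists A' => //; exists B'.
by move=> [a b] [/= /A'A Aa /B'B Bb]; exact: ABU.
Qed.

Section prod.
Context (m1 m2 : nat) (M1 : manifold R m1) (M2 : manifold R m2).

Definition prod_atlas : set (chart R (M1 * M2)%type (m1 + m2)) :=
  [set c | exists c1 c2, [/\ atlas c1, atlas c2 & c = prod_chart c1 c2]].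

Definition prod_chart_at (x : M1 * M2) : chart R (M1 * M2)%type (m1 + m2) :=
  prod_chart (chart_at x.1) (chart_at x.2).

Lemma prod_atlas_chart c : prod_atlas c -> is_chart c.
Proof.
by move=> [c1 [c2 [a1 a2 ->]]]; apply: prod_chartP; exact: atlas_chart.
Qed.

Lemma prod_atlas_smooth c c' : prod_atlas c -> prod_atlas c' ->
  smooth_on (c @` (cdom c `&` cdom c')) (c' \o cinv c).
Proof.
move=> [c1 [c2 [a1 a2 ->]]] [d1 [d2 [b1 b2 ->]]] k.
have -> : cdom (prod_chart c1 c2) `&` cdom (prod_chart d1 d2) =
    (cdom c1 `&` cdom d1) `*` (cdom c2 `&` cdom d2).
  by apply/seteqP; split=> -[p q] [[? ?] [? ?]].
rewrite prod_chart_image.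
have oi m (M : manifold R m) (e d : chart R M m) : atlas e -> atlas d ->
    open (e @` (cdom e `&` cdom d)).
  move=> ae ad; apply: open_chart_image; first exact: atlas_chart.
  by have [] := atlas_chart ad.
have := Ck_row_fun (oi _ _ _ _ a1 b1) (oi _ _ _ _ a2 b2)
  (atlas_smooth a1 b1 k) (atlas_smooth a2 b2 k).
exact.
Qed.

Lemma prod_chart_at_atlas x : prod_atlas (prod_chart_at x).
Proof.
by exists (chart_at x.1), (chart_at x.2); split=> //; exact: chart_at_atlas.
Qed.

Lemma prod_chart_at_dom x : cdom (prod_chart_at x) x.
Proof. by split; exact: chart_at_dom. Qed.

Definition prod_manifold : manifold R (m1 + m2) :=
  @Manifold R (m1 + m2) (M1 * M2)%type prod_atlas prod_chart_at
    (hausdorff_prod (@manifold_hausdorff _ _ M1) (@manifold_hausdorff _ _ M2))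
    (second_countable_prod (@manifold_countable _ _ M1)
                           (@manifold_countable _ _ M2))
    prod_atlas_chart prod_atlas_smooth prod_chart_at_atlas prod_chart_at_dom.
End prod.
End product_manifold.

Section riemannian.
Context (R : realType) (m : nat) (M : manifold R m).
Implicit Types (p q : M) (U : set M) (u v w x y z : 'rV[R]_m).
Implicit Types (X Y Z W : M -> 'rV[R]_m).

(* A tangent vector at p is represented by its components in the chart
   chart_at p; tcoord c p v are its components in the chart c. *)
Definition tcoord (c : chart R M m) p v : 'rV[R]_m :=
  'D_v (c \o cinv (chart_at p)) (chart_at p p).

Definition ddir p v (f : M -> R) : R :=
  'D_v (f \o cinv (chart_at p)) (chart_at p p).

Definition smooth_fun U (f : M -> R) : Prop := forall c, atlas c ->
  smooth_on (c @` (cdom c `&` U)) (f \o cinv c).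

Definition vf_in (c : chart R M m) X : 'rV[R]_m -> 'rV[R]_m :=
  fun a => tcoord c (cinv c a) (X (cinv c a)).

Definition smooth_vf U X : Prop := forall c, atlas c ->
  smooth_on (c @` (cdom c `&` U)) (vf_in c X).

(* [X, Y]^i = X^j d_j Y^i - Y^j d_j X^i in the chart chart_at p *)
Definition bracket X Y : M -> 'rV[R]_m := fun p =>
  'D_(X p) (vf_in (chart_at p) Y) (chart_at p p) -
  'D_(Y p) (vf_in (chart_at p) X) (chart_at p p).

(* The vector field with constant components v in the chart chart_at p; it
   is smooth on the domain of that chart and takes the value v at p. *)
Definition coord_vf p v : M -> 'rV[R]_m := fun q =>
  'D_v (chart_at q \o cinv (chart_at p)) (chart_at p q).

Definition metric := M -> 'rV[R]_m -> 'rV[R]_m -> R.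

Record riemannian (g : metric) : Prop := Riemannian {
  metric_linear : forall p (a : R) u v w,
    g p (a *: u + v) w = a * g p u w + g p v w;
  metric_sym : forall p u v, g p u v = g p v u;
  metric_pos : forall p u, u != 0 -> 0 < g p u u;
  metric_smooth : forall U X Y, open U -> smooth_vf U X -> smooth_vf U Y ->
    smooth_fun U (fun p => g p (X p) (Y p)) }.

(* An affine connection acts on vector fields defined on open sets.  A field
   on U is encoded as a total function of which only the restriction to U
   matters: applying the Leibniz rule to indicator functions of open subsets
   of U shows that nabla X Y p depends only on the germs of X and Y at p. *)
Record connection (nabla : (M -> 'rV[R]_m) -> (M -> 'rV[R]_m) -> M -> 'rV[R]_m)
    : Prop := Connection {
  connection_smooth : forall U X Y, open U -> smooth_vf U X -> smooth_vf U Y ->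
    smooth_vf U (nabla X Y);
  connectionDl : forall U X X' Y, open U ->
    smooth_vf U X -> smooth_vf U X' -> smooth_vf U Y ->
    forall p, U p -> nabla (X \+ X') Y p = nabla X Y p + nabla X' Y p;
  connectionZl : forall U (f : M -> R) X Y, open U ->
    smooth_fun U f -> smooth_vf U X -> smooth_vf U Y ->
    forall p, U p -> nabla (fun q => f q *: X q) Y p = f p *: nabla X Y p;
  connectionDr : forall U X Y Y', open U ->
    smooth_vf U X -> smooth_vf U Y -> smooth_vf U Y' ->
    forall p, U p -> nabla X (Y \+ Y') p = nabla X Y p + nabla X Y' p;
  connection_leibniz : forall U (f : M -> R) X Y, open U ->
    smooth_fun U f -> smooth_vf U X -> smooth_vf U Y ->
    forall p, U p -> nabla X (fun q => f q *: Y q) p =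
      ddir p (X p) f *: Y p + f p *: nabla X Y p }.

Record levi_civita (g : metric)
    (nabla : (M -> 'rV[R]_m) -> (M -> 'rV[R]_m) -> M -> 'rV[R]_m)
    : Prop := LeviCivita {
  levi_civita_connection : connection nabla;
  levi_civita_torsion : forall U X Y, open U -> smooth_vf U X ->
    smooth_vf U Y -> forall p, U p ->
    nabla X Y p - nabla Y X p = bracket X Y p;
  levi_civita_metric : forall U X Y Z, open U -> smooth_vf U X ->
    smooth_vf U Y -> smooth_vf U Z -> forall p, U p ->
    ddir p (X p) (fun q => g q (Y q) (Z q)) =
      g p (nabla X Y p) (Z p) + g p (Y p) (nabla X Z p) }.

Section curvature.
Context (g : metric)
  (nabla : (M -> 'rV[R]_m) -> (M -> 'rV[R]_m) -> M -> 'rV[R]_m).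

Definition curv X Y Z : M -> 'rV[R]_m := fun p =>
  nabla X (nabla Y Z) p - nabla Y (nabla X Z) p - nabla (bracket X Y) Z p.

Definition Rm W Z X Y : M -> R := fun p => g p (W p) (curv X Y Z p).

(* The value of the tensor Rm on tangent vectors at p: the vectors are
   extended to fields near p with constant components in chart_at p. *)
Definition Rm_at p w z x y : R :=
  Rm (coord_vf p w) (coord_vf p z) (coord_vf p x) (coord_vf p y) p.

Definition orthonormal_basis p (e : 'I_m -> 'rV[R]_m) : Prop :=
  forall i j, g p (e i) (e j) = (i == j)%:R.

(* The traces are taken along a given orthonormal basis e of the tangent
   space at p. *)
Definition Ric p (e : 'I_m -> 'rV[R]_m) x y : R :=
  \sum_i Rm_at p (e i) x (e i) y.

Definition Scal p (e : 'I_m -> 'rV[R]_m) : R := \sum_i Ric p e (e i) (e i).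

Definition grad (f : M -> R) : M -> 'rV[R]_m := fun p =>
  get [set u | forall v, g p u v = ddir p v f].

Definition vnorm p v : R := Num.sqrt (g p v v).

Definition Hess (f : M -> R) p x y : R :=
  g p (nabla (coord_vf p x) (grad f) p) y.

Definition laplacian (f : M -> R) p (e : 'I_m -> 'rV[R]_m) : R :=
  \sum_i Hess f p (e i) (e i).
End curvature.
End riemannian.

(* The tangent space of the product at (p, q) is the direct sum of those of
   the factors: chart_at (p, q) is the product of chart_at p and chart_at q,
   so that row_mx u1 u2 represents the vector (u1, u2). *)
Definition warped (R : realType) (m1 m2 : nat) (M1 : manifold R m1)
    (M2 : manifold R m2) (g1 : metric M1) (g2 : metric M2) (lam : M1 -> R) :
    metric (prod_manifold M1 M2) :=
  fun x u v => g1 x.1 (lsubmx u) (lsubmx v) +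
               lam x.1 ^+ 2 * g2 x.2 (rsubmx u) (rsubmx v).

Definition vf_pair (R : realType) (m1 m2 : nat) (M1 : manifold R m1)
    (M2 : manifold R m2) (X1 : prod_manifold M1 M2 -> 'rV[R]_m1)
    (X2 : prod_manifold M1 M2 -> 'rV[R]_m2) :
    prod_manifold M1 M2 -> 'rV[R]_(m1 + m2) :=
  fun x => row_mx (X1 x) (X2 x).

(* Main.v *)
Require Import Defs.
From HB Require Import structures.
From mathcomp Require Import all_boot all_order all_algebra.
From mathcomp Require Import all_classical all_reals all_analysis.
From mathcomp Require Import ring lra.
Import Order.TTheory GRing.Theory Num.Theory.
Import numFieldNormedType.Exports.

Set Implicit Arguments.
Unset Strict Implicit.
Unset Printing Implicit Defensive.

Local Open Scope classical_set_scope.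
Local Open Scope ring_scope.

(** The Levi-Civita connection of the warped product is computed on lifts: for
    fields [X = (X1, X2)] and [Y = (Y1, Y2)] whose components are fields of the
    factors,
      [nabla_X Y = (nabla_X1 Y1 - lam g2(X2, Y2) grad lam,
                    nabla_X2 Y2 + (X1 lam / lam) Y2 + (Y1 lam / lam) X2)].
    The right-hand side is compatible with the metric and torsion free, and a
    difference of two such expressions is symmetric in its first two arguments
    and antisymmetric in the last two, hence zero.  Iterating the formula with
    the Leibniz rule gives the curvature on lifts.  Curvature is tensorial
    (linearity in the last field uses [[X, Y] f = X (Y f) - Y (X f)], that is,
    Schwarz's theorem in charts), so that lifts suffice.  The traces are then
    taken along the orthonormal basis made of [e1] and [lam^-1 e2], after
    observing that the trace of a bilinear form does not depend on the
    orthonormal basis. *)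

(** * Calculus of C^k functions *)

(** The connection of the product is known only through its axioms. Lifts are the fields on which
    these axioms determine it by data of the factors: brackets of lifts split, and the derivative of
    the product metric on lifts is a derivative of [g1] plus one of [lam^2 g2]. The obstacle is that
    [nabla_Y Z] of two lifts is no longer a lift, since the coefficient [lam g2(Y2, Z2)] depends on
    both factors. It is therefore written as a combination of lifts with coefficients on the product
    before the outer derivative is taken. Brackets are kept out of the computations as far as
    possible: torsion-freeness replaces [nabla_[X, Y]] by a difference of covariant derivatives,
    which also yields the smoothness of [[X, Y]]. Since [grad] is a choice among representing
    vectors, its existence and smoothness have to come from an explicit formula in charts; this is
    why the calculus below goes as far as inverse matrices. *)

Section Ck_calculus.
Context (R : realType).
Implicit Types V W : normedModType R.

Lemma open_near (T : topologicalType) (U : set T) x :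
  open U -> U x -> \forall y \near x, U y.
Proof. by move=> oU Ux; exact: open_nbhs_nbhs. Qed.

Lemma derive_ext V W (U : set V) (f g : V -> W) x v : open U -> U x ->
  (forall y, U y -> f y = g y) -> 'D_v f x = 'D_v g x.
Proof.
move=> oU Ux fg; apply: near_eq_derive; near=> y.
by apply: fg; near: y; exact: open_near.
Unshelve. all: by end_near. Qed.

Lemma derive_fM V (f g : V -> R) x v :
  differentiable f x -> differentiable g x ->
  'D_v (fun y => f y * g y) x = f x * 'D_v g x + g x * 'D_v f x.
Proof.
move=> df dg.
exact (deriveM (@diff_derivable _ _ _ _ _ v df) (@diff_derivable _ _ _ _ _ v dg)).
Qed.

Lemma derive_fD V W (f g : V -> W) x v :
  differentiable f x -> differentiable g x ->
  'D_v (fun y => f y + g y) x = 'D_v f x + 'D_v g x.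
Proof.
by move=> /(@diff_derivable _ _ _ _ _ v) df /(@diff_derivable _ _ _ _ _ v) dg;
  exact: deriveD.
Qed.

Lemma differentiable_fsum V W (I : Type) (r : seq I) (f : I -> V -> W) x :
  (forall i, differentiable (f i) x) ->
  differentiable (fun y => \sum_(i <- r) f i y) x.
Proof.
move=> df; elim: r => [|i r IH].
  rewrite (_ : (fun y => _) = cst 0); first exact: differentiable_cst.
  by apply/funext => y; rewrite big_nil.
rewrite (_ : (fun y => _) = f i + (fun y => \sum_(i <- r) f i y)).
  exact: differentiableD.
by apply/funext => y; rewrite big_cons.
Qed.

Lemma derive_fsum V W (I : Type) (r : seq I) (f : I -> V -> W) x v :
  (forall i, differentiable (f i) x) ->
  'D_v (fun y => \sum_(i <- r) f i y) x = \sum_(i <- r) 'D_v (f i) x.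
Proof.
move=> df; elim: r => [|i r IH].
  rewrite (_ : (fun y => _) = cst 0) ?derive_cst ?big_nil//.
  by apply/funext => y; rewrite big_nil.
rewrite big_cons -IH -derive_fD//; last exact: differentiable_fsum.
by congr ('D_v _ x); apply/funext => y; rewrite big_cons.
Qed.

Lemma differentiable_mxP V m n (f : V -> 'M[R]_(m, n)) x :
  differentiable f x <-> forall i j, differentiable (fun y => f y i j) x.
Proof.
split=> [df i j|df].
  exact: (differentiable_comp df (differentiable_coord (f x) i j)).
have -> : f = fun y => \sum_i \sum_j f y i j *: delta_mx i j.
  by apply/funext => y; exact: matrix_sum_delta.
apply: differentiable_fsum => i; apply: differentiable_fsum => j.
exact: differentiableZl.
Qed.

Lemma derive_mxE V m n (f : V -> 'M[R]_(m, n)) x v i j : differentiable f x ->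
  ('D_v f x) i j = 'D_v (fun y => f y i j) x.
Proof. by move=> df; rewrite derive_mx ?mxE//; exact: diff_derivable. Qed.

(** [Ck] speaks of derivatives along fixed vectors only; this expansion reduces derivatives along
    varying directions to those. *)
Lemma derive_deltaE W n (f : 'rV[R]_n -> W) x v : differentiable f x ->
  'D_v f x = \sum_j v 0 j *: 'D_(delta_mx 0 j) f x.
Proof.
move=> df; rewrite deriveE// {1}(row_sum_delta v) linear_sum.
by apply: eq_bigr => j _; rewrite linearZ/= deriveE.
Qed.

Lemma derive_compE V W W' (g : V -> W) (f : W -> W') x v :
  differentiable g x -> differentiable f (g x) ->
  'D_v (f \o g) x = 'D_('D_v g x) f (g x).
Proof.
move=> dg df; rewrite !deriveE//; last exact: differentiable_comp.
by rewrite diff_comp.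
Qed.

Lemma Ck_sub V W k (U U' : set V) (f : V -> W) :
  U' `<=` U -> Ck k U f -> Ck k U' f.
Proof.
move=> sU; elim: k f => [|k IH] f /=; first by move=> cf x /sU; exact: cf.
by move=> [df Df]; split=> [x /sU|v]; [exact: df|exact: IH].
Qed.

Lemma CkS V W k (U : set V) (f : V -> W) : Ck k.+1 U f -> Ck k U f.
Proof.
elim: k f => [f [df _] x Ux|k IH f [df Df]].
  exact/differentiable_continuous/df.
by split=> // v; exact: IH (Df v).
Qed.

Lemma Ck_cst V W k (U : set V) (a : W) : Ck k U (cst a).
Proof.
elim: k a => [|k IH] a /=; first by move=> x _; exact: cst_continuous.
split=> [x _|v]; first exact: differentiable_cst.
rewrite (_ : (fun x => _) = cst 0); first exact: IH.
by apply/funext => x; exact: derive_cst.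
Qed.

Lemma CkD V W k (U : set V) (f g : V -> W) : open U ->
  Ck k U f -> Ck k U g -> Ck k U (fun x => f x + g x).
Proof.
move=> oU; elim: k f g => [|k IH] f g /=.
  by move=> cf cg x Ux; apply: continuousD; [exact: cf|exact: cg].
move=> [df Df] [dg Dg]; split=> [x Ux|v].
  by apply: differentiableD; [exact: df|exact: dg].
apply: Ck_ext (IH _ _ (Df v) (Dg v)) => // x Ux.
by rewrite derive_fD//; [exact: df|exact: dg].
Qed.

Lemma Ck_sum V W k (U : set V) (I : Type) (r : seq I) (f : I -> V -> W) :
  open U -> (forall i, Ck k U (f i)) -> Ck k U (fun x => \sum_(i <- r) f i x).
Proof.
move=> oU Cf; elim: r => [|i r IH].
  rewrite (_ : (fun x => _) = cst 0); first exact: Ck_cst.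
  by apply/funext => y; rewrite big_nil.
rewrite (_ : (fun x => _) = fun x => f i x + \sum_(i <- r) f i x).
  exact: CkD.
by apply/funext => y; rewrite big_cons.
Qed.

Lemma CkM V k (U : set V) (f g : V -> R) : open U ->
  Ck k U f -> Ck k U g -> Ck k U (fun x => f x * g x).
Proof.
move=> oU; elim: k f g => [|k IH] f g.
  by move=> cf cg x Ux; apply: continuousM; [exact: cf|exact: cg].
move=> Cf Cg; have [[df Df] [dg Dg]] := (Cf, Cg); split=> [x Ux|v].
  by apply: differentiableM; [exact: df|exact: dg].
(* The Leibniz rule multiplies a derivative by an undifferentiated factor, which [CkS] brings down
   to the same order [k]. *)
have H := CkD oU (IH _ _ (CkS Cf) (Dg v)) (IH _ _ (CkS Cg) (Df v)).
refine (Ck_ext oU _ H).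
by move=> x Ux; rewrite derive_fM//; [exact: df|exact: dg].
Qed.

Lemma Ck_prod V k (U : set V) (I : Type) (r : seq I) (f : I -> V -> R) :
  open U -> (forall i, Ck k U (f i)) -> Ck k U (fun x => \prod_(i <- r) f i x).
Proof.
move=> oU Cf; elim: r => [|i r IH].
  rewrite (_ : (fun x => _) = cst 1); first exact: Ck_cst.
  by apply/funext => y; rewrite big_nil.
rewrite (_ : (fun x => _) = fun x => f i x * \prod_(i <- r) f i x).
  exact: CkM.
by apply/funext => y; rewrite big_cons.
Qed.

Lemma CkV V k (U : set V) (f : V -> R) : open U ->
  (forall x, U x -> f x != 0) -> Ck k U f -> Ck k U (fun x => (f x)^-1).
Proof.
move=> oU f0; elim: k => [|k IH] Cf.
  by move=> x Ux; apply: continuousV; [exact: f0|exact: Cf].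
have [df Df] := Cf; split=> [x Ux|v].
  by apply: differentiableV; [exact: df|exact: f0].
have CV := IH (CkS Cf).
have CN : Ck k U (cst (-1 : R)) by exact: Ck_cst.
apply: Ck_ext (CkM oU (CkM oU CN (CkM oU CV CV)) (Df v)) => //.
move=> x Ux; rewrite deriveV ?f0//; last exact/diff_derivable/df.
by rewrite mulN1r -expr2 exprVn.
Qed.

Lemma Ck_mxP V k (U : set V) m n (f : V -> 'M[R]_(m, n)) : open U ->
  Ck k U f <-> forall i j, Ck k U (fun x => f x i j).
Proof.
move=> oU; split=> [|Cf].
  elim: k f => [|k IH] f /=.
    move=> cf i j x Ux; apply: (@continuous_comp _ _ _ f (fun M => M i j)).
      exact: cf.
    exact: coord_continuous.
  move=> [df Df] i j; split=> [x Ux|v].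
    by have /differentiable_mxP := df x Ux; exact.
  apply: Ck_ext (IH _ (Df v) i j) => // x Ux.
  by rewrite derive_mxE//; exact: df.
elim: k f Cf => [|k IH] f /= Cf.
  move=> x Ux.
  apply/cvgrPdist_le => e e0; near=> y.
  (* The norm is the maximum over finitely many entries, so the entrywise estimates hold on a common
     neighbourhood. *)
  rewrite /Num.Def.normr/= mx_normrE (bigmax_le _ (ltW e0))//= => i _.
  rewrite !mxE; move: i; near: y; apply: filter_forall => -[i j] /=.
  exact: ((cvgrPdist_le _ _).1 (Cf i j x Ux)).
have df x : U x -> differentiable f x.
  by move=> Ux; apply/differentiable_mxP => i j; have [+ _] := Cf i j; exact.
split=> // v; apply: IH => i j; have [_ /(_ v)] := Cf i j.
by apply: Ck_ext => // x Ux; rewrite derive_mxE//; exact: df.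
Unshelve. all: by end_near. Qed.

Lemma CkZ V k (U : set V) n (f : V -> R) (X : V -> 'rV[R]_n) : open U ->
  Ck k U f -> Ck k U X -> Ck k U (fun x => f x *: X x).
Proof.
move=> oU Cf /Ck_mxP CX; apply/Ck_mxP => // i j.
apply: Ck_ext (CkM oU Cf (CX oU i j)) => // x _.
by rewrite mxE.
Qed.

Lemma Ck_coord k n (U : set 'rV[R]_n) i : open U -> Ck k U (fun x => x 0 i).
Proof.
move=> oU; case: k => [x _|k]; first exact: coord_continuous.
split=> [x _|v]; first exact: differentiable_coord.
apply: Ck_ext (Ck_cst k U (v 0 i)) => // x _.
by rewrite -(@derive_mxE _ _ _ id)// derive_id.
Qed.

(** By the chain rule the derivative along [v] is the sum over [i] of [(D_v g)_i] times
    [(D_i f) \o g]; the induction hypothesis applies to each partial derivative [D_i f]. *)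
Lemma Ck_comp_real V k n (U : set V) (U' : set 'rV[R]_n)
    (g : V -> 'rV[R]_n) (f : 'rV[R]_n -> R) : open U -> open U' ->
    (forall x, U x -> U' (g x)) -> Ck k U g -> Ck k U' f ->
  Ck k U (f \o g).
Proof.
move=> oU oU' UU'; elim: k f => [|k IH] f.
  by move=> cg cf x Ux; apply: continuous_comp; [exact: cg|apply/cf/UU'].
move=> Cg [df Df]; have [dg Dg] := Cg; split=> [x Ux|v].
  by apply: differentiable_comp; [exact: dg|apply/df/UU'].
have Dgv i : Ck k U (fun x => ('D_v g x) 0 i).
  exact: (Ck_mxP k _ oU).1 (Dg v) 0 i.
have Dfi i : Ck k U ((fun y => 'D_(delta_mx 0 i) f y) \o g).
  exact: IH (CkS Cg) (Df _).
have := @Ck_sum V _ k U _ (index_enum 'I_n) _ oU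
  (fun i => CkM oU (Dgv i) (Dfi i)).
apply: Ck_ext => // x Ux; have dfg := df _ (UU' _ Ux).
by rewrite (derive_compE v (dg _ Ux) dfg) [RHS]derive_deltaE.
Qed.

Lemma Ck_comp V k n p (U : set V) (U' : set 'rV[R]_n)
    (g : V -> 'rV[R]_n) (f : 'rV[R]_n -> 'rV[R]_p) : open U -> open U' ->
    (forall x, U x -> U' (g x)) -> Ck k U g -> Ck k U' f ->
  Ck k U (f \o g).
Proof.
move=> oU oU' UU' Cg Cf; apply/Ck_mxP => // i j.
exact: (Ck_comp_real oU oU' UU' Cg ((Ck_mxP k _ oU').1 Cf i j)).
Qed.

Lemma Ck_derive_real k n (U : set 'rV[R]_n) (X : 'rV[R]_n -> 'rV[R]_n)
    (f : 'rV[R]_n -> R) : open U ->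
  Ck k U X -> Ck k.+1 U f -> Ck k U (fun x => 'D_(X x) f x).
Proof.
move=> oU CX [df Df].
have CXi i : Ck k U (fun x => X x 0 i).
  exact: (Ck_mxP k _ oU).1 CX 0 i.
have := @Ck_sum _ _ k U _ (index_enum 'I_n) _ oU
  (fun i => CkM oU (CXi i) (Df (delta_mx 0 i))).
by apply: Ck_ext => // x Ux; rewrite [RHS]derive_deltaE//; exact: df.
Qed.

Lemma Ck_det V k n (U : set V) (A : V -> 'M[R]_n) : open U ->
  Ck k U A -> Ck k U (fun x => \det (A x)).
Proof.
move=> oU /Ck_mxP CA; apply: Ck_sum => // s.
by apply: CkM => //; [exact: Ck_cst|apply: Ck_prod => // i; exact: CA].
Qed.

(** Cramer's rule: the entry [(i, j)] of the inverse is the cofactor of [(j, i)] divided by the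
    determinant, hence the transposed indices below. *)
Lemma Ck_invmx V k n (U : set V) (A : V -> 'M[R]_n) : open U ->
  (forall x, U x -> A x \in unitmx) -> Ck k U A ->
  Ck k U (fun x => invmx (A x)).
Proof.
move=> oU uA CA; have CAij := (Ck_mxP _ _ oU).1 CA; apply/Ck_mxP => // i j.
have CV : Ck k U (fun x => (\det (A x))^-1).
  apply: CkV => //; last exact: Ck_det.
  by move=> x /uA; rewrite unitmxE unitfE.
have CM : Ck k U (fun x => \det (row' j (col' i (A x)))).
  apply: Ck_det => //; apply/Ck_mxP => // i' j'.
  by apply: Ck_ext (CAij (lift j i') (lift i j')) => // x _; rewrite !mxE.
have CN : Ck k U (cst ((-1) ^+ (j + i) : R)) by exact: Ck_cst.
apply: Ck_ext (CkM oU CV (CkM oU CN CM)) => //.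
by move=> x Ux; rewrite /invmx uA// !mxE.
Qed.

Lemma Ck_mulmx V k m n p (U : set V) (A : V -> 'M[R]_(m, n))
    (B : V -> 'M[R]_(n, p)) : open U ->
  Ck k U A -> Ck k U B -> Ck k U (fun x => A x *m B x).
Proof.
move=> oU /Ck_mxP CA /Ck_mxP CB; apply/Ck_mxP => // i j.
have := @Ck_sum _ _ k U _ (index_enum 'I_n) _ oU
  (fun l => CkM oU (CA oU i l) (CB oU l j)).
by apply: Ck_ext => // x Ux; rewrite mxE.
Qed.

End Ck_calculus.

(** * Schwarz's theorem on mixed derivatives *)

Section schwarz.
Context (R : realType) (V : normedModType R).
Implicit Types (f : V -> R) (x y u v : V).

Lemma derive_translate (W : normedModType R) (f : V -> W) a x u :
  'D_u (fun y => f (a + y)) x = 'D_u f (a + x).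
Proof.
rewrite /derive; set F := fun h => _; set G := fun h => _.
by have -> : F = G by apply/funext => h; rewrite /F /G /= addrCA.
Qed.

Lemma differentiable_translate (W : normedModType R) (f : V -> W) a x :
  differentiable f (a + x) -> differentiable (fun y => f (a + y)) x.
Proof.
have dt : differentiable (fun y => a + y) x by exact: differentiableD.
by move=> df; exact: (differentiable_comp dt df).
Qed.

Lemma MVT_line f x u (h : R) : 0 < h ->
    (forall s : R, 0 <= s <= h -> differentiable f (s *: u + x)) ->
  exists2 s, 0 <= s <= h & f (h *: u + x) - f x = 'D_u f (s *: u + x) * h.
Proof.
move=> h0 df; have dline s : 0 <= s <= h ->
    is_derive s 1 (fun s => f (s *: u + x)) ('D_u f (s *: u + x)).
  move=> sh; have dl : differentiable (fun s : R => s *: u + x) s by [].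
  have dfl : differentiable (f \o fun s : R => s *: u + x) s.
    by apply: differentiable_comp => //; exact: df.
  apply: DeriveDef; first exact: diff_derivable dfl.
  rewrite (@derive_compE R R V R _ _ s 1 dl (df s sh)); congr ('D_ _ _ _).
  have -> : (fun s : R => s *: u + x) = *:%R^~ u + cst x by [].
  by rewrite deriveE ?diff_val /= ?addr0 ?scale1r.
have [s sh E] : exists2 s, s \in `]0, h[%R &
    f (h *: u + x) - f (0 *: u + x) = 'D_u f (s *: u + x) * (h - 0).
  apply: (@MVT R (fun s => f (s *: u + x)) (fun s => 'D_u f (s *: u + x)) 0 h) =>
    // [s /itvP sh|]; first by apply: dline; rewrite !sh.
  apply: derivable_within_continuous => s; rewrite in_itv/= => sh.
  by have [] := dline s sh.
exists s; first by rewrite !(itvP sh).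
by move: E; rewrite scale0r add0r subr0.
Qed.

(** The mean value theorem is applied twice: along [u] to the increment of [f] by [h *: v], then
    along [v] to ['D_u f]. The second difference is thus [h ^+ 2] times a mixed derivative at some
    point of a parallelogram shrinking to [x], where that derivative is continuous. *)
Lemma second_difference (U : set V) f x u v (e : R) : open U -> U x ->
    Ck 2 U f -> 0 < e ->
  \forall h \near 0^'+,
    `|(f (h *: v + (h *: u + x)) + f x - (f (h *: u + x) + f (h *: v + x)))
       / h ^+ 2 - 'D_v (fun y => 'D_u f y) x| < e.
Proof.
move=> oU Ux [df Df] e0; have [dDf DDf] := Df u.
have : \forall y \near x,
    U y /\ `|'D_v (fun y => 'D_u f y) x - 'D_v (fun y => 'D_u f y) y| < e.
  near=> y; split; first by near: y; exact: open_near.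
  by near: y; have /cvgrPdist_lt := DDf v x Ux; exact.
move=> /nbhs_ballP[r /= r0 xr].
(* The parallelogram spanned by [h *: u] and [h *: v] at [x] lies in the ball. *)
have Nr s t h : 0 <= s <= h -> 0 <= t <= h -> h * (`|u| + `|v|) < r ->
    ball x r (t *: v + (s *: u + x)).
  move=> /andP[s0 sh] /andP[t0 th]; rewrite -ball_normE /ball_/=.
  apply: le_lt_trans.
  rewrite -normrN (_ : - _ = t *: v + s *: u); last first.
    by rewrite opprB addrA addrK.
  rewrite (le_trans (ler_normD _ _))// !normrZ !ger0_norm// mulrDr addrC.
  by rewrite lerD// ler_wpM2r.
near=> h; have h0 : 0 < h by near: h; exact: nbhs_right_gt.
have hr : h * (`|u| + `|v|) < r.
  (* The added 1 keeps the divisor positive when both vectors are zero. *)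
  have k0 : 0 < `|u| + `|v| + 1 by rewrite ltr_wpDl// addr_ge0.
  have : h < r / (`|u| + `|v| + 1).
    by near: h; apply: nbhs_right_lt; rewrite divr_gt0.
  rewrite ltr_pdivlMr//; apply: le_lt_trans.
  by rewrite ler_pM2l// lerDl.
have hh : 0 <= h <= h by apply/andP; split=> //; exact: ltW.
have z0 : 0 <= (0 : R) <= h by apply/andP; split=> //; exact: ltW.
have Us s t : 0 <= s <= h -> 0 <= t <= h -> U (t *: v + (s *: u + x)).
  by move=> sh th; have [] := xr _ (Nr s t h sh th hr).
have Us0 s : 0 <= s <= h -> U (s *: u + x).
  by move=> sh; have := Us s 0 sh z0; rewrite scale0r add0r.
pose F y := f (h *: v + y) - f y.
have dF1 s : 0 <= s <= h -> differentiable (fun y => f (h *: v + y)) (s *: u + x).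
  by move=> sh; apply: differentiable_translate; exact/df/Us.
have [s sh] : exists2 s, 0 <= s <= h &
    F (h *: u + x) - F x = 'D_u F (s *: u + x) * h.
  apply: MVT_line => // s sh; apply: differentiableB; first exact: dF1.
  exact/df/Us0.
have -> : 'D_u F (s *: u + x) =
    'D_u f (h *: v + (s *: u + x)) - 'D_u f (s *: u + x).
  rewrite deriveB; last 2 first.
  - exact/diff_derivable/dF1.
  - exact/diff_derivable/df/Us0.
  by rewrite derive_translate.
have [t th ->] : exists2 t, 0 <= t <= h &
    'D_u f (h *: v + (s *: u + x)) - 'D_u f (s *: u + x) =
    'D_v (fun y => 'D_u f y) (t *: v + (s *: u + x)) * h.
  by apply: (@MVT_line (fun y => 'D_u f y)) => // t th; exact/dDf/Us.
(* The second difference is the increment of [F] from [x] to [h *: u + x]. *)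
rewrite /F => E; have -> : f (h *: v + (h *: u + x)) + f x -
    (f (h *: u + x) + f (h *: v + x)) =
    f (h *: v + (h *: u + x)) - f (h *: u + x) - (f (h *: v + x) - f x) by ring.
rewrite E -mulrA -expr2 mulfK ?expf_neq0 ?gt_eqF// distrC.
by have [] := xr _ (Nr s t h sh th hr).
Unshelve. all: by end_near. Qed.

(** The second difference is symmetric in [u] and [v], so for a common small [h] both mixed
    derivatives are within [e] of the same number. *)
Lemma derive_comm (U : set V) f x u v : open U -> U x -> Ck 2 U f ->
  'D_v (fun y => 'D_u f y) x = 'D_u (fun y => 'D_v f y) x.
Proof.
have close_trans (a b p e : R) :
    `|p - a| < e -> `|p - b| < e -> `|a - b| < e + e.
  by rewrite distrC => pa pb; exact: le_lt_trans (ler_distD p a b) (ltrD pa pb).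
move=> oU Ux Cf; set a := LHS; set b := RHS.
have close e : 0 < e -> `|a - b| < e + e.
  move=> e0.
  have [h [pa pb]] := @filter_ex _ _ _ _ (filterI
    (second_difference u v oU Ux Cf e0) (second_difference v u oU Ux Cf e0)).
  move: pb; rewrite (addrCA (h *: u)) (addrC (f (h *: v + x))) => pb.
  exact: close_trans pa pb.
apply/eqP; rewrite -subr_eq0; apply/negPn/negP; rewrite -normr_gt0 => d0.
by have := close _ (divr_gt0 d0 (ltr0n R 2)); rewrite -splitr ltxx.
Qed.

End schwarz.

(** * Charts, smooth functions and vector fields *)

Section directional_field.
Context (R : realType) (m : nat).

(** Separates the first order part, where the field is differentiated, from the second order part,
    where its direction is frozen at [a]. In a commutator the former gives the bracket and the
    latter cancels. *)
Lemma derive_derive_field (U : set 'rV[R]_m) (Y : 'rV[R]_m -> 'rV[R]_m)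
    (F : 'rV[R]_m -> R) a x : U a ->
    Ck 1 U Y -> Ck 2 U F -> open U ->
  'D_x (fun b => 'D_(Y b) F b) a =
  'D_('D_x Y a) F a + 'D_x (fun b => 'D_(Y a) F b) a.
Proof.
move=> Ua [dY _] [dF DF] oU; have /differentiable_mxP dYi := dY _ Ua.
have dDF i : differentiable (fun b => 'D_(delta_mx 0 i) F b) a.
  by have [+ _] := DF (delta_mx 0 i); exact.
have E (u : 'rV[R]_m -> 'rV[R]_m) : 'D_x (fun b => 'D_(u b) F b) a =
    'D_x (fun b => \sum_i u b 0 i * 'D_(delta_mx 0 i) F b) a.
  by apply: derive_ext oU Ua _ => b /dF; exact: derive_deltaE.
rewrite !E (derive_deltaE _ (dF _ Ua)) !derive_fsum; last 2 first.
- by move=> i; apply: differentiableM.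
- by move=> i; exact: differentiableM.
rewrite -big_split; apply: eq_bigr => i _ /=.
rewrite !derive_fM//= derive_cst mulr0 addr0 addrC; congr (_ + _).
by rewrite mulrC derive_mxE//; exact: dY.
Qed.

End directional_field.

Section charts.
Context (R : realType) (m : nat) (M : manifold R m).
Implicit Types (p q : M) (U : set M) (u v w x y z : 'rV[R]_m).
Implicit Types (X Y Z W : M -> 'rV[R]_m) (f h : M -> R) (c : chart R M m).

Lemma chart_img_open c U : atlas c -> open U -> open (c @` (cdom c `&` U)).
Proof. by move=> /atlas_chart; exact: open_chart_image. Qed.

Lemma atlas_open c : atlas c -> open (cdom c).
Proof. by case/atlas_chart. Qed.

Lemma atlasK c p : atlas c -> cdom c p -> cinv c (c p) = p.
Proof. by case/atlas_chart => _ _ + _ _; exact. Qed.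

Lemma chart_near c U p : atlas c -> open U -> cdom c p -> U p ->
  \forall a \near c p, [/\ cdom c (cinv c a), U (cinv c a) & c (cinv c a) = a].
Proof.
move=> ac oU cp Up; have := open_near (chart_img_open ac oU).
move=> /(_ (c p)) []; first by exists p.
move=> r /= r0 h; exists r => //= a /h [q [cq Uq] <-].
by rewrite atlasK.
Qed.

Lemma chart_img_inv c U a : atlas c -> (c @` (cdom c `&` U)) a ->
  [/\ cdom c (cinv c a), U (cinv c a) & c (cinv c a) = a].
Proof. by move=> ac [q [cq Uq] <-]; rewrite atlasK. Qed.

Lemma transition_diff c c' p : atlas c -> atlas c' -> cdom c p -> cdom c' p ->
  differentiable (c' \o cinv c) (c p).
Proof.
move=> ac ac' cp cp'; have [d _] := atlas_smooth ac ac' 1.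
by apply: d; exists p.
Qed.

(** Near [c p], reading [G] in [c] is reading it in [c'] after the transition map. With [G] a
    function or a chart this gives the transformation rules of directional derivatives and of
    components. *)
Lemma derive_chart (W : normedModType R) (G : M -> W) c c' p v :
    atlas c -> atlas c' -> cdom c p -> cdom c' p ->
    differentiable (G \o cinv c') (c' p) ->
  'D_v (G \o cinv c) (c p) =
  'D_('D_v (c' \o cinv c) (c p)) (G \o cinv c') (c' p).
Proof.
move=> ac ac' cp cp' dG; have dc := transition_diff ac ac' cp cp'.
have K : (c' \o cinv c) (c p) = c' p by rewrite /= atlasK.
rewrite -[in RHS]K -derive_compE ?K//.
apply: near_eq_derive; apply: filterS (chart_near ac (atlas_open ac') cp cp').
by move=> a [_ ca _] /=; rewrite atlasK.
Qed.

Lemma ddirE c p v f : atlas c -> cdom c p ->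
  differentiable (f \o cinv c) (c p) ->
  ddir p v f = 'D_(tcoord c p v) (f \o cinv c) (c p).
Proof.
move=> ac cp; apply: derive_chart => //; first exact: chart_at_atlas.
exact: chart_at_dom.
Qed.

Lemma tcoord_trans c c' p v : atlas c -> atlas c' -> cdom c p -> cdom c' p ->
  tcoord c' p v = 'D_(tcoord c p v) (c' \o cinv c) (c p).
Proof.
move=> ac ac' cp cp'; apply: derive_chart (transition_diff ac ac' cp cp') => //.
  exact: chart_at_atlas.
exact: chart_at_dom.
Qed.

Lemma tcoord_self p v : tcoord (chart_at p) p v = v.
Proof.
rewrite /tcoord -[RHS](derive_id (chart_at p p) v).
apply: near_eq_derive; have cp := chart_at_dom p.
apply: filterS (chart_near (chart_at_atlas p) openT cp I).
by move=> a [].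
Qed.

Lemma tcoordK c p v : atlas c -> cdom c p ->
  'D_(tcoord c p v) (chart_at p \o cinv c) (c p) = v.
Proof.
move=> ac cp; rewrite -tcoord_trans ?tcoord_self//; first exact: chart_at_atlas.
exact: chart_at_dom.
Qed.

Lemma tcoord_inj c p : atlas c -> cdom c p -> injective (tcoord c p).
Proof. by move=> ac cp u v E; rewrite -(tcoordK u ac cp) E tcoordK. Qed.

Lemma tcoordE c p v : atlas c -> cdom c p ->
  tcoord c p v = 'd (c \o cinv (chart_at p)) (chart_at p p) v.
Proof.
move=> ac cp; rewrite /tcoord deriveE//; apply: transition_diff => //.
  exact: chart_at_atlas.
exact: chart_at_dom.
Qed.

Lemma tcoordZ c p a u : atlas c -> cdom c p ->
  tcoord c p (a *: u) = a *: tcoord c p u.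
Proof. by move=> ac cp; rewrite !tcoordE// linearZ. Qed.

Lemma tcoordD c p u v : atlas c -> cdom c p ->
  tcoord c p (u + v) = tcoord c p u + tcoord c p v.
Proof. by move=> ac cp; rewrite !tcoordE// linearD. Qed.

Lemma tcoord_sum c p (I : Type) (r : seq I) (u : I -> 'rV[R]_m) :
    atlas c -> cdom c p ->
  tcoord c p (\sum_(i <- r) u i) = \sum_(i <- r) tcoord c p (u i).
Proof.
move=> ac cp; rewrite tcoordE// linear_sum.
by apply: eq_bigr => i _; rewrite tcoordE.
Qed.

Lemma tcoord_coord_vf c p v q : atlas c -> cdom c q -> cdom (chart_at p) q ->
  tcoord c q (coord_vf p v q) = 'D_v (c \o cinv (chart_at p)) (chart_at p q).
Proof.
move=> ac cq cpq; rewrite /tcoord /coord_vf.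
rewrite -(@derive_chart _ c (chart_at p) (chart_at q))//.
- exact: chart_at_atlas.
- exact: chart_at_atlas.
- exact: chart_at_dom.
- by apply: transition_diff => //; [exact: chart_at_atlas|exact: chart_at_dom].
Qed.

Lemma tcoord_coord_vf_self p v q : cdom (chart_at p) q ->
  tcoord (chart_at p) q (coord_vf p v q) = v.
Proof.
move=> cpq; have ap := chart_at_atlas p; rewrite tcoord_coord_vf//.
rewrite -[RHS](derive_id (chart_at p q) v).
apply: near_eq_derive; apply: filterS (chart_near ap openT cpq I).
by move=> a [].
Qed.

Lemma coord_vf_at p v : coord_vf p v p = v.
Proof.
apply: (tcoord_inj (chart_at_atlas p) (chart_at_dom p)).
by rewrite tcoord_coord_vf_self ?tcoord_self//; exact: chart_at_dom.
Qed.

(** The coordinate fields form a frame over the whole chart domain, because their components in that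
    chart are constant. *)
Lemma coord_vf_expand p q w : cdom (chart_at p) q ->
  w = \sum_i (tcoord (chart_at p) q w) 0 i *: coord_vf p (delta_mx 0 i) q.
Proof.
move=> cq; have ap := chart_at_atlas p; apply: (tcoord_inj ap cq).
rewrite [LHS]row_sum_delta.
rewrite tcoord_sum//; apply: eq_bigr => i _.
by rewrite tcoordZ// tcoord_coord_vf_self.
Qed.

End charts.

(** * Smooth functions and fields, and derivatives along fields *)

Section smooth.
Context (R : realType) (m : nat) (M : manifold R m).
Implicit Types (p q : M) (U : set M) (u v w x y z : 'rV[R]_m).
Implicit Types (X Y Z W : M -> 'rV[R]_m) (f h : M -> R) (c : chart R M m).

Lemma chart_img_sub c U U' : U' `<=` U ->
  c @` (cdom c `&` U') `<=` c @` (cdom c `&` U).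
Proof. by move=> sU _ [q [cq /sU Uq] <-]; exists q. Qed.

Lemma smooth_fun_sub U U' f : U' `<=` U -> smooth_fun U f -> smooth_fun U' f.
Proof.
by move=> sU sf c ac k; apply: Ck_sub (sf c ac k); exact: chart_img_sub.
Qed.

Lemma smooth_vf_sub U U' X : U' `<=` U -> smooth_vf U X -> smooth_vf U' X.
Proof.
by move=> sU sX c ac k; apply: Ck_sub (sX c ac k); exact: chart_img_sub.
Qed.

Lemma smooth_fun_ext U f h : open U -> (forall p, U p -> f p = h p) ->
  smooth_fun U f -> smooth_fun U h.
Proof.
move=> oU fh sf c ac k; apply: Ck_ext (sf c ac k); first exact: chart_img_open.
by move=> a /(chart_img_inv ac)[_ /fh].
Qed.

Lemma smooth_vf_ext U X Y : open U -> (forall p, U p -> X p = Y p) ->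
  smooth_vf U X -> smooth_vf U Y.
Proof.
move=> oU XY sX c ac k; apply: Ck_ext (sX c ac k); first exact: chart_img_open.
by move=> a /(chart_img_inv ac)[_ /XY + _]; rewrite /vf_in => ->.
Qed.

Lemma smooth_cst U (a : R) : smooth_fun U (cst a).
Proof. by move=> c ac k; exact: Ck_cst. Qed.

Lemma smooth_funM U f h : open U -> smooth_fun U f -> smooth_fun U h ->
  smooth_fun U (fun p => f p * h p).
Proof.
move=> oU sf sh c ac k; have oc := chart_img_open ac oU.
exact: (CkM oc (sf c ac k) (sh c ac k)).
Qed.

Lemma smooth_funV U f : open U -> (forall p, U p -> f p != 0) ->
  smooth_fun U f -> smooth_fun U (fun p => (f p)^-1).
Proof.
move=> oU f0 sf c ac k; have oc := chart_img_open ac oU.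
have f0c a : (c @` (cdom c `&` U)) a -> (f \o cinv c) a != 0.
  by move=> /(chart_img_inv ac)[_ /f0].
exact: (CkV oc f0c (sf c ac k)).
Qed.

Lemma smooth_vfD U X Y : open U -> smooth_vf U X -> smooth_vf U Y ->
  smooth_vf U (X \+ Y).
Proof.
move=> oU sX sY c ac k; have oc := chart_img_open ac oU.
apply: Ck_ext (CkD oc (sX c ac k) (sY c ac k)) => // a.
by move=> /(chart_img_inv ac)[ca _ _]; rewrite /vf_in tcoordD.
Qed.

Lemma smooth_vfZ U f X : open U -> smooth_fun U f -> smooth_vf U X ->
  smooth_vf U (fun p => f p *: X p).
Proof.
move=> oU sf sX c ac k; have oc := chart_img_open ac oU.
apply: Ck_ext (CkZ oc (sf c ac k) (sX c ac k)) => // a.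
by move=> /(chart_img_inv ac)[ca _ _]; rewrite /vf_in tcoordZ.
Qed.

Lemma smooth_vf0 U : open U -> smooth_vf U (fun=> 0).
Proof.
move=> oU c ac k; apply: Ck_ext (Ck_cst k _ (0 : 'rV[R]_m)).
  exact: chart_img_open.
move=> a /(chart_img_inv ac)[ca _ _]; rewrite /vf_in.
by rewrite -(scale0r (0 : 'rV[R]_m)) tcoordZ// !scale0r.
Qed.

Lemma smooth_vf_sum U (I : Type) (r : seq I) (X : I -> M -> 'rV[R]_m) :
  open U -> (forall i, smooth_vf U (X i)) ->
  smooth_vf U (fun p => \sum_(i <- r) X i p).
Proof.
move=> oU sX; elim: r => [|i r IH].
  by apply: smooth_vf_ext (smooth_vf0 oU) => // p _; rewrite big_nil.
by apply: smooth_vf_ext (smooth_vfD oU (sX i) IH) => // p _; rewrite big_cons.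
Qed.

Lemma smooth_fun_diff U f c p : smooth_fun U f -> atlas c -> cdom c p -> U p ->
  differentiable (f \o cinv c) (c p).
Proof. by move=> sf ac cp Up; have [d _] := sf c ac 1; apply: d; exists p. Qed.

Lemma smooth_vf_diff U X c p : smooth_vf U X -> atlas c -> cdom c p -> U p ->
  differentiable (vf_in c X) (c p).
Proof. by move=> sX ac cp Up; have [d _] := sX c ac 1; apply: d; exists p. Qed.

Lemma smooth_ddir U X f : open U -> smooth_vf U X -> smooth_fun U f ->
  smooth_fun U (fun p => ddir p (X p) f).
Proof.
move=> oU sX sf c ac k; have oc := chart_img_open ac oU.
apply: Ck_ext (Ck_derive_real oc (sX c ac k) (sf c ac k.+1)) => // a.
move=> /(chart_img_inv ac)[ca Ua Ka] /=.
rewrite (ddirE _ ac ca); last exact: smooth_fun_diff sf ac ca Ua.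
by rewrite /vf_in Ka.
Qed.

Lemma smooth_coord_vf p v : smooth_vf (cdom (chart_at p)) (coord_vf p v).
Proof.
have ap := chart_at_atlas p; have oU := atlas_open ap.
move=> c ac k; have oc := chart_img_open ac oU.
have oi := chart_img_open ap (atlas_open ac).
(* In the chart [c] the field is a derivative of one transition map composed with the inverse
   transition, so one extra order of smoothness is spent. *)
have [_ /(_ v) CD] := atlas_smooth ap ac k.+1.
have to_img a : (c @` (cdom c `&` cdom (chart_at p))) a ->
    (chart_at p @` (cdom (chart_at p) `&` cdom c)) ((chart_at p \o cinv c) a).
  by move=> /(chart_img_inv ac)[ca Ua _]; exists (cinv c a).
refine (Ck_ext oc _ (Ck_comp oc oi to_img (atlas_smooth ac ap k) CD)) => a.
move=> /(chart_img_inv ac)[ca Ua _] /=.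
by rewrite /vf_in tcoord_coord_vf.
Qed.

Lemma smooth_coef U X p i : open U -> smooth_vf U X ->
  smooth_fun (U `&` cdom (chart_at p))
    (fun q => (tcoord (chart_at p) q (X q)) 0 i).
Proof.
move=> oU sX; have ap := chart_at_atlas p; have oD := atlas_open ap.
move=> c ac k; have oc := chart_img_open ac (openI oU oD).
have oi := chart_img_open ap oU.
have CX := (Ck_mxP k _ oi).1 (sX _ ap k) 0 i.
have sub : c @` (cdom c `&` (U `&` cdom (chart_at p))) `<=`
    c @` (cdom c `&` cdom (chart_at p)).
  by apply: chart_img_sub => q [].
have to_img a : (c @` (cdom c `&` (U `&` cdom (chart_at p)))) a ->
    (chart_at p @` (cdom (chart_at p) `&` U)) ((chart_at p \o cinv c) a).
  by move=> /(chart_img_inv ac)[ca [Ua cpa] _]; exists (cinv c a).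
have Cg := Ck_sub sub (atlas_smooth ac ap k).
refine (Ck_ext oc _ (Ck_comp_real oc oi to_img Cg CX)) => a.
move=> /(chart_img_inv ac)[ca [Ua cpa] _] /=.
by rewrite /vf_in atlasK.
Qed.

Lemma ddir_ext U f h p v : open U -> U p -> (forall q, U q -> f q = h q) ->
  ddir p v f = ddir p v h.
Proof.
move=> oU Up fh; apply: near_eq_derive.
apply: filterS (chart_near (chart_at_atlas p) oU (chart_at_dom p) Up).
by move=> a [_ /fh].
Qed.

Lemma ddir_cst p v (a : R) : ddir p v (cst a) = 0.
Proof. exact: derive_cst. Qed.

Lemma ddirD U f h p v : smooth_fun U f -> smooth_fun U h -> U p ->
  ddir p v (fun q => f q + h q) = ddir p v f + ddir p v h.
Proof.
move=> sf sh Up; have ap := chart_at_atlas p; have cp := chart_at_dom p.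
have [df dh] := (smooth_fun_diff sf ap cp Up, smooth_fun_diff sh ap cp Up).
exact: derive_fD.
Qed.

Lemma ddirM U f h p v : smooth_fun U f -> smooth_fun U h -> U p ->
  ddir p v (fun q => f q * h q) = f p * ddir p v h + h p * ddir p v f.
Proof.
move=> sf sh Up; have ap := chart_at_atlas p; have cp := chart_at_dom p.
have [df dh] := (smooth_fun_diff sf ap cp Up, smooth_fun_diff sh ap cp Up).
by rewrite [LHS](derive_fM v df dh) /= atlasK.
Qed.

Lemma ddirV U f p v : smooth_fun U f -> U p -> f p != 0 ->
  ddir p v (fun q => (f q)^-1) = - (f p) ^- 2 * ddir p v f.
Proof.
move=> sf Up f0; have ap := chart_at_atlas p; have cp := chart_at_dom p.
have df := smooth_fun_diff sf ap cp Up.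
have K : (f \o cinv (chart_at p)) (chart_at p p) = f p by rewrite /= atlasK.
by rewrite -K; apply: deriveV; [rewrite /= atlasK|exact: diff_derivable].
Qed.

Lemma ddir_linear U f p a u v : smooth_fun U f -> U p ->
  ddir p (a *: u + v) f = a * ddir p u f + ddir p v f.
Proof.
move=> sf Up; have ap := chart_at_atlas p; have cp := chart_at_dom p.
have df := smooth_fun_diff sf ap cp Up.
by rewrite /ddir !deriveE// linearP.
Qed.

(* The second order part of X(Yf) is symmetric in X and Y by Schwarz. *)
Lemma ddir_bracket U X Y f p : open U -> U p ->
    smooth_vf U X -> smooth_vf U Y -> smooth_fun U f ->
  ddir p (bracket X Y p) f =
  ddir p (X p) (fun q => ddir q (Y q) f) - ddir p (Y p) (fun q => ddir q (X q) f).
Proof.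
move=> oU Up sX sY sf; have ap := chart_at_atlas p; have cp := chart_at_dom p.
set c := chart_at p in ap cp *; have oc := chart_img_open ap oU.
have Ic : (c @` (cdom c `&` U)) (c p) by exists p.
have df := smooth_fun_diff sf ap cp Up.
have Kv V : vf_in c V (c p) = V p by rewrite /vf_in atlasK// tcoord_self.
have E u V : smooth_vf U V -> ddir p u (fun q => ddir q (V q) f) =
    'D_('D_u (vf_in c V) (c p)) (f \o cinv c) (c p) +
    'D_u (fun b => 'D_(V p) (f \o cinv c) b) (c p).
  move=> sV; rewrite -(Kv V).
  have H := derive_derive_field u Ic (sV c ap 1) (sf c ap 2) oc.
  refine (etrans _ H); apply: derive_ext oc Ic _ => a.
  move=> /(chart_img_inv ap)[ca Ua Ka]; rewrite -{2}Ka.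
  exact: ddirE (smooth_fun_diff sf ap ca Ua).
have lin (u v : 'rV[R]_m) : 'D_(u - v) (f \o cinv c) (c p) =
    'D_u (f \o cinv c) (c p) - 'D_v (f \o cinv c) (c p).
  by rewrite (deriveE _ df) linearB -(deriveE u df) -(deriveE v df).
have cancel (a b s : R) : a - b = (a + s) - (b + s).
  by rewrite opprD addrACA subrr addr0.
rewrite (E _ _ sX) (E _ _ sY) (derive_comm (X p) (Y p) oc Ic (sf c ap 2)).
refine (etrans _ (cancel _ _ _)).
exact: lin.
Qed.

End smooth.

(** * Connections and curvature *)

(* Bundling connections gives [rewrite] a head constant to match on. *)
Record affine_connection (R : realType) (m : nat) (M : manifold R m) := Affine {
  covd :> (M -> 'rV[R]_m) -> (M -> 'rV[R]_m) -> M -> 'rV[R]_m;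
  covdP : connection covd }.

Section connections.
Context (R : realType) (m : nat) (M : manifold R m).
Context (nabla : affine_connection M).
Let hC := covdP nabla.
Implicit Types (p q : M) (U : set M) (u v w x y z : 'rV[R]_m).
Implicit Types (X Y Z W : M -> 'rV[R]_m) (f h : M -> R).

Lemma smooth_indic U : open U -> smooth_fun U (\1_U : M -> R).
Proof.
move=> oU; apply: (@smooth_fun_ext _ _ _ _ (cst 1)) (smooth_cst _ _) => // p Up.
by rewrite indicE mem_set.
Qed.

Lemma indic_scale_ext U X Y : (forall p, U p -> X p = Y p) ->
  (fun p => (\1_U p : R) *: X p) = (fun p => (\1_U p : R) *: Y p).
Proof.
move=> XY; apply/funext => p; rewrite indicE.
by case: (asboolP (U p)) => [Up|nU]; [rewrite XY|rewrite memNset// !scale0r].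
Qed.

(** Multiplied by [\1_U] the two fields coincide as total functions, and function-linearity pulls
    the factor out again with value 1 at [p]. *)
Lemma nabla_extl U X X' Y p : open U -> U p -> (forall q, U q -> X q = X' q) ->
  smooth_vf U X -> smooth_vf U Y -> nabla X Y p = nabla X' Y p.
Proof.
move=> oU Up XX' sX sY; have sX' := smooth_vf_ext oU XX' sX.
have s1 := smooth_indic oU.
have := connectionZl hC oU s1 sX sY Up.
rewrite (indic_scale_ext XX') (connectionZl hC oU s1 sX' sY Up).
by rewrite indicE mem_set// !scale1r.
Qed.

(** As for [nabla_extl], with the Leibniz rule: [\1_U] is constant near [p], so its derivative
    vanishes there. *)
Lemma nabla_extr U X Y Y' p : open U -> U p -> (forall q, U q -> Y q = Y' q) ->
  smooth_vf U X -> smooth_vf U Y -> nabla X Y p = nabla X Y' p.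
Proof.
move=> oU Up YY' sX sY; have sY' := smooth_vf_ext oU YY' sY.
have s1 := smooth_indic oU.
have := connection_leibniz hC oU s1 sX sY Up.
rewrite (indic_scale_ext YY') (connection_leibniz hC oU s1 sX sY' Up).
have -> : ddir p (X p) \1_U = 0.
  rewrite -(ddir_cst p (X p) 1); apply: ddir_ext oU Up _ => q Uq.
  by rewrite indicE mem_set.
by rewrite indicE mem_set// !scale1r !scale0r !add0r.
Qed.

Lemma nablaZr U (a : R) X Y p : open U -> U p -> smooth_vf U X ->
  smooth_vf U Y -> nabla X (fun q => a *: Y q) p = a *: nabla X Y p.
Proof.
move=> oU Up sX sY.
have := connection_leibniz hC oU (smooth_cst (M := M) U a) sX sY Up.
by rewrite ddir_cst scale0r add0r.
Qed.

Lemma nabla0r X p U : open U -> U p -> smooth_vf U X -> nabla X (fun=> 0) p = 0.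
Proof.
move=> oU Up sX; have E := nablaZr 0 oU Up sX (smooth_vf0 oU).
refine (etrans _ (etrans E (scale0r _))); congr (nabla _ _ _).
by apply/funext => q /=; rewrite scaler0.
Qed.

Lemma smooth_vfB U X Y : open U -> smooth_vf U X -> smooth_vf U Y ->
  smooth_vf U (fun q => X q - Y q).
Proof.
move=> oU sX sY; have sN := smooth_vfZ oU (smooth_cst (M := M) U (-1)) sY.
by apply: smooth_vf_ext (smooth_vfD oU sX sN) => // q _; rewrite /= scaleN1r.
Qed.

Lemma nablaBl U X X' Y p : open U -> U p -> smooth_vf U X -> smooth_vf U X' ->
  smooth_vf U Y -> nabla (fun q => X q - X' q) Y p = nabla X Y p - nabla X' Y p.
Proof.
move=> oU Up sX sX' sY.
have s1 := smooth_cst (M := M) U (-1); have sN := smooth_vfZ oU s1 sX'.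
have E : (fun q => X q - X' q) = X \+ (fun q => cst (-1) q *: X' q).
  by apply/funext => q /=; rewrite scaleN1r.
rewrite E (connectionDl hC oU sX sN sY Up) (connectionZl hC oU s1 sX' sY Up).
by rewrite scaleN1r.
Qed.

Lemma nablaBr U X Y Y' p : open U -> U p -> smooth_vf U X -> smooth_vf U Y ->
  smooth_vf U Y' -> nabla X (fun q => Y q - Y' q) p = nabla X Y p - nabla X Y' p.
Proof.
move=> oU Up sX sY sY'.
have sN := smooth_vfZ oU (smooth_cst (M := M) U (-1)) sY'.
have E : (fun q => Y q - Y' q) = Y \+ (fun q => cst (-1) q *: Y' q).
  by apply/funext => q /=; rewrite scaleN1r.
rewrite E (connectionDr hC oU sX sY sN Up) (nablaZr _ oU Up sX sY').
by rewrite scaleN1r.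
Qed.

(* Expand the field in the coordinate frame; multiplying by [\1_U] makes [T]
   local. *)
Lemma tensorial_value (T : (M -> 'rV[R]_m) -> 'rV[R]_m) (U0 : set M) p :
    open U0 -> U0 p ->
    (forall U X Y, open U -> U p -> U `<=` U0 -> smooth_vf U X ->
      smooth_vf U Y -> T (X \+ Y) = T X + T Y) ->
    (forall U f X, open U -> U p -> U `<=` U0 -> smooth_fun U f ->
      smooth_vf U X -> T (fun q => f q *: X q) = f p *: T X) ->
  forall X, smooth_vf U0 X -> T X = T (coord_vf p (X p)).
Proof.
move=> oU0 Up0 TD TZ.
have ap := chart_at_atlas p; have oD := atlas_open ap.
have cp := chart_at_dom p.
set U := U0 `&` cdom (chart_at p); have oU : open U by exact: openI.
have Up : U p by split.
have UU0 : U `<=` U0 by move=> ? [].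
have Uc : U `<=` cdom (chart_at p) by move=> ? [].
have T0 : T (fun=> 0) = 0.
  have := TZ U (cst 0) _ oU Up UU0 (smooth_cst _ _) (smooth_vf0 oU).
  move=> E; refine (etrans _ (etrans E (scale0r _))); congr (T _).
  by apply/funext => q; rewrite /= scaler0.
have Text X Y : smooth_vf U X -> (forall q, U q -> X q = Y q) -> T X = T Y.
  move=> sX XY; have s1 := smooth_indic oU; have sY := smooth_vf_ext oU XY sX.
  have := TZ U _ _ oU Up UU0 s1 sX; rewrite (indic_scale_ext XY).
  by rewrite (TZ U _ _ oU Up UU0 s1 sY) indicE mem_set// !scale1r.
have Tsum (I : Type) (r : seq I) (X : I -> M -> 'rV[R]_m) :
    (forall i, smooth_vf U (X i)) ->
    T (fun q => \sum_(i <- r) X i q) = \sum_(i <- r) T (X i).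
  move=> sX; elim: r => [|i r IH].
    rewrite big_nil -[RHS]T0; congr (T _); apply/funext => q.
    by rewrite big_nil.
  rewrite big_cons -IH.
  rewrite -(TD U _ _ oU Up UU0 (sX i) (smooth_vf_sum r oU sX)).
  by congr (T _); apply/funext => q; rewrite big_cons.
have sE i : smooth_vf U (coord_vf p (delta_mx 0 i)).
  exact: smooth_vf_sub Uc (smooth_coord_vf _ _).
have TE X : smooth_vf U X ->
    T X = \sum_i (X p) 0 i *: T (coord_vf p (delta_mx 0 i)).
  move=> sX; have sf i : smooth_fun U (fun q => (tcoord (chart_at p) q (X q)) 0 i).
    apply: smooth_fun_sub (smooth_coef p i oU sX) => q Uq.
    by split=> //; exact: Uc.
  rewrite (Text X (fun q => \sum_i (tcoord (chart_at p) q (X q)) 0 i *: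
    coord_vf p (delta_mx 0 i) q))//; last first.
    by move=> q /Uc; exact: coord_vf_expand.
  rewrite Tsum; last by move=> i; exact: smooth_vfZ oU (sf i) (sE i).
  apply: eq_bigr => i _; rewrite (TZ U _ _ oU Up UU0 (sf i) (sE i)).
  by rewrite tcoord_self.
move=> X /(smooth_vf_sub UU0) sX.
have sX' : smooth_vf U (coord_vf p (X p)).
  exact: smooth_vf_sub Uc (smooth_coord_vf _ _).
by rewrite (TE _ sX) (TE _ sX') coord_vf_at.
Qed.

(** * Tensoriality of the curvature *)

Section curvature.
Hypothesis torsion_free : forall U X Y, open U -> smooth_vf U X ->
  smooth_vf U Y -> forall p, U p ->
  nabla X Y p - nabla Y X p = bracket X Y p.

(** [bracket] reads a different chart at each point, which makes its smoothness awkward in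
    coordinates; as a difference of covariant derivatives it is immediate. *)
Lemma smooth_bracket U X Y : open U -> smooth_vf U X -> smooth_vf U Y ->
  smooth_vf U (bracket X Y).
Proof.
move=> oU sX sY; have sXY := connection_smooth hC oU sX sY.
have sYX := connection_smooth hC oU sY sX.
apply: smooth_vf_ext (smooth_vfB oU sXY sYX) => // q Uq.
exact: torsion_free oU sX sY q Uq.
Qed.

(** With this the curvature contains no bracket, and linearity in [X] and [Y] follows from the
    axioms and the locality of the connection. *)
Lemma nabla_bracket U X Y Z p : open U -> U p -> smooth_vf U X ->
  smooth_vf U Y -> smooth_vf U Z ->
  nabla (bracket X Y) Z p = nabla (nabla X Y) Z p - nabla (nabla Y X) Z p.
Proof.
move=> oU Up sX sY sZ; have sXY := connection_smooth hC oU sX sY.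
have sYX := connection_smooth hC oU sY sX.
rewrite -(nablaBl oU Up sXY sYX sZ).
apply: (nabla_extl oU Up _ (smooth_bracket oU sX sY) sZ) => q Uq.
by rewrite (torsion_free oU sX sY Uq).
Qed.

(** Transfers linearity from the first slot to the second, in [curvDm] and [curvZm]. *)
Lemma curvC U X Y Z p : open U -> U p -> smooth_vf U X -> smooth_vf U Y ->
  smooth_vf U Z -> curv nabla X Y Z p = - curv nabla Y X Z p.
Proof.
move=> oU Up sX sY sZ; have E1 := nabla_bracket oU Up sX sY sZ.
have E2 := nabla_bracket oU Up sY sX sZ.
move: E1 E2; rewrite /curv; move: (bracket X Y) (bracket Y X) => B B' -> ->.
by apply/rowP => i; rewrite !mxE; ring.
Qed.

Lemma curvDl U X X' Y Z p : open U -> U p -> smooth_vf U X -> smooth_vf U X' ->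
  smooth_vf U Y -> smooth_vf U Z ->
  curv nabla (X \+ X') Y Z p = curv nabla X Y Z p + curv nabla X' Y Z p.
Proof.
move=> oU Up sX sX' sY sZ; have sC := connection_smooth hC oU.
have sXX' := smooth_vfD oU sX sX'.
have E1 := nabla_bracket oU Up sXX' sY sZ.
have E2 := nabla_bracket oU Up sX sY sZ.
have E3 := nabla_bracket oU Up sX' sY sZ.
move: E1 E2 E3; rewrite /curv.
move: (bracket (X \+ X') Y) (bracket X Y) (bracket X' Y) => B B' B'' -> -> ->.
rewrite (connectionDl hC oU sX sX' (sC _ _ sY sZ) Up).
have -> : nabla Y (nabla (X \+ X') Z) p =
    nabla Y (nabla X Z) p + nabla Y (nabla X' Z) p.
  rewrite -(connectionDr hC oU sY (sC _ _ sX sZ) (sC _ _ sX' sZ) Up).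
  apply: (nabla_extr oU Up _ sY (sC _ _ sXX' sZ)) => q Uq.
  by have := connectionDl hC oU sX sX' sZ Uq.
have -> : nabla (nabla (X \+ X') Y) Z p =
    nabla (nabla X Y) Z p + nabla (nabla X' Y) Z p.
  rewrite -(connectionDl hC oU (sC _ _ sX sY) (sC _ _ sX' sY) sZ Up).
  apply: (nabla_extl oU Up _ (sC _ _ sXX' sY) sZ) => q Uq.
  by have := connectionDl hC oU sX sX' sY Uq.
have -> : nabla (nabla Y (X \+ X')) Z p =
    nabla (nabla Y X) Z p + nabla (nabla Y X') Z p.
  rewrite -(connectionDl hC oU (sC _ _ sY sX) (sC _ _ sY sX') sZ Up).
  apply: (nabla_extl oU Up _ (sC _ _ sY sXX') sZ) => q Uq.
  by have := connectionDr hC oU sY sX sX' Uq.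
by apply/rowP => i; rewrite !mxE; ring.
Qed.

(** The derivative of [f] along [Y] enters twice with opposite signs: through
    [nabla_Y (f nabla_X Z)], and through [nabla_Y (f X)] inside the bracket term. *)
Lemma curvZl U f X Y Z p : open U -> U p -> smooth_fun U f -> smooth_vf U X ->
  smooth_vf U Y -> smooth_vf U Z ->
  curv nabla (fun q => f q *: X q) Y Z p = f p *: curv nabla X Y Z p.
Proof.
move=> oU Up sf sX sY sZ; have sC := connection_smooth hC oU.
have sfX := smooth_vfZ oU sf sX; have sYf := smooth_ddir oU sY sf.
have E1 := nabla_bracket oU Up sfX sY sZ.
have E2 := nabla_bracket oU Up sX sY sZ.
move: E1 E2; rewrite /curv.
move: (bracket (fun q => f q *: X q) Y) (bracket X Y) => B B' -> ->.
rewrite (connectionZl hC oU sf sX (sC _ _ sY sZ) Up).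
have -> : nabla Y (nabla (fun q => f q *: X q) Z) p =
    ddir p (Y p) f *: nabla X Z p + f p *: nabla Y (nabla X Z) p.
  rewrite -(connection_leibniz hC oU sf sY (sC _ _ sX sZ) Up).
  apply: (nabla_extr oU Up _ sY (sC _ _ sfX sZ)) => q Uq.
  by have := connectionZl hC oU sf sX sZ Uq.
have -> : nabla (nabla (fun q => f q *: X q) Y) Z p =
    f p *: nabla (nabla X Y) Z p.
  rewrite -(connectionZl hC oU sf (sC _ _ sX sY) sZ Up).
  apply: (nabla_extl oU Up _ (sC _ _ sfX sY) sZ) => q Uq.
  by have := connectionZl hC oU sf sX sY Uq.
have -> : nabla (nabla Y (fun q => f q *: X q)) Z p =
    ddir p (Y p) f *: nabla X Z p + f p *: nabla (nabla Y X) Z p.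
  have sYX := sC _ _ sY sX.
  rewrite -(connectionZl hC oU sYf sX sZ Up) -(connectionZl hC oU sf sYX sZ Up).
  rewrite -(connectionDl hC oU (smooth_vfZ oU sYf sX) (smooth_vfZ oU sf sYX) sZ Up).
  apply: (nabla_extl oU Up _ (sC _ _ sY sfX) sZ) => q Uq.
  by have := connection_leibniz hC oU sf sY sX Uq.
by apply/rowP => i; rewrite !mxE; ring.
Qed.

Lemma curvDr U X Y Z Z' p : open U -> U p -> smooth_vf U X -> smooth_vf U Y ->
  smooth_vf U Z -> smooth_vf U Z' ->
  curv nabla X Y (Z \+ Z') p = curv nabla X Y Z p + curv nabla X Y Z' p.
Proof.
move=> oU Up sX sY sZ sZ'; have sC := connection_smooth hC oU.
have sZZ' := smooth_vfD oU sZ sZ'.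
have D V V' : smooth_vf U V -> smooth_vf U V' ->
    nabla V (nabla V' (Z \+ Z')) p =
    nabla V (nabla V' Z) p + nabla V (nabla V' Z') p.
  move=> sV sV'.
  rewrite -(connectionDr hC oU sV (sC _ _ sV' sZ) (sC _ _ sV' sZ') Up).
  apply: (nabla_extr oU Up _ sV (sC _ _ sV' sZZ')) => q Uq.
  by have := connectionDr hC oU sV' sZ sZ' Uq.
have E := connectionDr hC oU (smooth_bracket oU sX sY) sZ sZ' Up.
move: E; rewrite /curv; move: (bracket X Y) => B ->.
rewrite (D _ _ sX sY) (D _ _ sY sX).
by apply/rowP => i; rewrite !mxE; ring.
Qed.

Lemma curvZr U f X Y Z p : open U -> U p -> smooth_fun U f -> smooth_vf U X ->
  smooth_vf U Y -> smooth_vf U Z ->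
  curv nabla X Y (fun q => f q *: Z q) p = f p *: curv nabla X Y Z p.
Proof.
move=> oU Up sf sX sY sZ; have sC := connection_smooth hC oU.
have sfZ := smooth_vfZ oU sf sZ.
(* The two middle terms are exchanged when [V] and [V'] are, so they drop out of the commutator. *)
have D V V' : smooth_vf U V -> smooth_vf U V' ->
    nabla V (nabla V' (fun q => f q *: Z q)) p =
    (ddir p (V p) (fun q => ddir q (V' q) f) *: Z p +
     ddir p (V' p) f *: nabla V Z p) +
    (ddir p (V p) f *: nabla V' Z p + f p *: nabla V (nabla V' Z) p).
  move=> sV sV'; have sV'f := smooth_ddir oU sV' sf; have sV'Z := sC _ _ sV' sZ.
  rewrite -(connection_leibniz hC oU sV'f sV sZ Up).
  rewrite -(connection_leibniz hC oU sf sV sV'Z Up).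
  rewrite -(connectionDr hC oU sV (smooth_vfZ oU sV'f sZ)
    (smooth_vfZ oU sf sV'Z) Up).
  apply: (nabla_extr oU Up _ sV (sC _ _ sV' sfZ)) => q Uq.
  by have := connection_leibniz hC oU sf sV' sZ Uq.
have sB := smooth_bracket oU sX sY.
have E := connection_leibniz hC oU sf sB sZ Up.
move: E; rewrite /curv (ddir_bracket oU Up sX sY sf).
move: (bracket X Y) => B ->; rewrite (D _ _ sX sY) (D _ _ sY sX).
move: (ddir p (X p) (fun q => ddir q (Y q) f)) (ddir p (X p) f) => a b.
move: (ddir p (Y p) (fun q => ddir q (X q) f)) (ddir p (Y p) f) => c d.
by apply/rowP => i; rewrite !mxE; ring.
Qed.

Lemma curvDm U X Y Y' Z p : open U -> U p -> smooth_vf U X -> smooth_vf U Y ->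
  smooth_vf U Y' -> smooth_vf U Z ->
  curv nabla X (Y \+ Y') Z p = curv nabla X Y Z p + curv nabla X Y' Z p.
Proof.
move=> oU Up sX sY sY' sZ; have sYY' := smooth_vfD oU sY sY'.
rewrite (curvC oU Up sX sYY' sZ) (curvDl oU Up sY sY' sX sZ) opprD.
by rewrite (curvC oU Up sX sY sZ) (curvC oU Up sX sY' sZ).
Qed.

Lemma curvZm U f X Y Z p : open U -> U p -> smooth_fun U f -> smooth_vf U X ->
  smooth_vf U Y -> smooth_vf U Z ->
  curv nabla X (fun q => f q *: Y q) Z p = f p *: curv nabla X Y Z p.
Proof.
move=> oU Up sf sX sY sZ; have sfY := smooth_vfZ oU sf sY.
rewrite (curvC oU Up sX sfY sZ) (curvZl oU Up sf sY sX sZ).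
by rewrite (curvC oU Up sX sY sZ) scalerN.
Qed.

Definition curv_at p x y z :=
  curv nabla (coord_vf p x) (coord_vf p y) (coord_vf p z) p.

Lemma curvE U X Y Z p : open U -> U p -> smooth_vf U X -> smooth_vf U Y ->
  smooth_vf U Z -> curv nabla X Y Z p = curv_at p (X p) (Y p) (Z p).
Proof.
move=> oU Up; set U0 := U `&` cdom (chart_at p).
have ap := chart_at_atlas p; have oD := atlas_open ap.
have oU0 : open U0 by exact: openI.
have Up0 : U0 p by split=> //; exact: chart_at_dom.
have UU0 : U0 `<=` U by move=> ? [].
have sE v : smooth_vf U0 (coord_vf p v).
  by apply: smooth_vf_sub (smooth_coord_vf _ _) => ? [].
move=> /(smooth_vf_sub UU0) sX /(smooth_vf_sub UU0) sY /(smooth_vf_sub UU0) sZ.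
rewrite /curv_at.
have T1 : curv nabla X Y Z p = curv nabla (coord_vf p (X p)) Y Z p.
  apply: (@tensorial_value (fun X => curv nabla X Y Z p) U0 p) => //.
    move=> V A B oV Vp sV sA sB.
    exact: (curvDl oV Vp sA sB (smooth_vf_sub sV sY) (smooth_vf_sub sV sZ)).
  move=> V f A oV Vp sV sf sA.
  exact: (curvZl oV Vp sf sA (smooth_vf_sub sV sY) (smooth_vf_sub sV sZ)).
(* From here on the first slot holds the coordinate field with the same value at [p], and
   [tensorial_value] is applied to the next slot. *)
have {}sX := sE (X p); move: (coord_vf p (X p)) sX T1 => X' sX ->.
have T2 : curv nabla X' Y Z p = curv nabla X' (coord_vf p (Y p)) Z p.
  apply: (@tensorial_value (fun Y => curv nabla X' Y Z p) U0 p) => //.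
    move=> V A B oV Vp sV sA sB.
    exact: (curvDm oV Vp (smooth_vf_sub sV sX) sA sB (smooth_vf_sub sV sZ)).
  move=> V f A oV Vp sV sf sA.
  exact: (curvZm oV Vp sf (smooth_vf_sub sV sX) sA (smooth_vf_sub sV sZ)).
have {}sY := sE (Y p); move: (coord_vf p (Y p)) sY T2 => Y' sY ->.
apply: (@tensorial_value (fun Z => curv nabla X' Y' Z p) U0 p) => //.
  move=> V A B oV Vp sV sA sB.
  exact: (curvDr oV Vp (smooth_vf_sub sV sX) (smooth_vf_sub sV sY) sA sB).
move=> V f A oV Vp sV sf sA.
exact: (curvZr oV Vp sf (smooth_vf_sub sV sX) (smooth_vf_sub sV sY) sA).
Qed.

Section linear.
Context (p : M).
Let U := cdom (chart_at p).
Let oU : open U. Proof. exact: atlas_open (chart_at_atlas p). Qed.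
Let Up : U p. Proof. exact: chart_at_dom. Qed.
Let sE v : smooth_vf U (coord_vf p v). Proof. exact: smooth_coord_vf. Qed.
(* Used by [done] in the three lemmas below. *)
Let sD a u v :
  smooth_vf U ((fun q => cst a q *: coord_vf p u q) \+ coord_vf p v).
Proof. exact: smooth_vfD oU (smooth_vfZ oU (smooth_cst _ _) (sE _)) (sE _). Qed.

Let sumE a u v :
  a *: u + v = ((fun q => cst a q *: coord_vf p u q) \+ coord_vf p v) p.
Proof. by rewrite /= !coord_vf_at. Qed.

Lemma curv_at_linearl y z : linear (fun x => curv_at p x y z).
Proof.
move=> a u v; have s1 := smooth_cst (M := M) U a.
rewrite sumE -[y in LHS](coord_vf_at p) -[z in LHS](coord_vf_at p) -(@curvE U)//.
rewrite (curvDl oU Up (smooth_vfZ oU s1 (sE u)))//.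
by rewrite (curvZl oU Up s1).
Qed.

Lemma curv_at_linearm x z : linear (fun y => curv_at p x y z).
Proof.
move=> a u v; have s1 := smooth_cst (M := M) U a.
rewrite sumE -[x in LHS](coord_vf_at p) -[z in LHS](coord_vf_at p) -(@curvE U)//.
rewrite (curvDm oU Up (sE x) (smooth_vfZ oU s1 (sE u)))//.
by rewrite (curvZm oU Up s1).
Qed.

Lemma curv_at_linearr x y : linear (curv_at p x y).
Proof.
move=> a u v; have s1 := smooth_cst (M := M) U a.
rewrite sumE -[x in LHS](coord_vf_at p) -[y in LHS](coord_vf_at p) -(@curvE U)//.
rewrite (curvDr oU Up (sE x) (sE y) (smooth_vfZ oU s1 (sE u)))//.
by rewrite (curvZr oU Up s1).
Qed.

End linear.

End curvature.
End connections.

(** * Metrics and gradients *)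

Section inner_products.
Context (R : realType) (m : nat).
Implicit Types (u v w : 'rV[R]_m) (B : 'rV[R]_m -> 'rV[R]_m -> R).

Record bilinear_form B : Prop := BilinearForm {
  bilin_l : forall a u v w, B (a *: u + v) w = a * B u w + B v w;
  bilin_r : forall a u v w, B u (a *: v + w) = a * B u v + B u w }.

Section bilinear.
Context B (hB : bilinear_form B).

Lemma bilinDl u v w : B (u + v) w = B u w + B v w.
Proof. by rewrite -[u in LHS]scale1r (bilin_l hB) mul1r. Qed.

Lemma bilinDr u v w : B u (v + w) = B u v + B u w.
Proof. by rewrite -[v in LHS]scale1r (bilin_r hB) mul1r. Qed.

Lemma bilin0l v : B 0 v = 0.
Proof. by apply: (addrI (B 0 v)); rewrite -bilinDl !addr0. Qed.

Lemma bilin0r v : B v 0 = 0.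
Proof. by apply: (addrI (B v 0)); rewrite -bilinDr !addr0. Qed.

Lemma bilinZl a u v : B (a *: u) v = a * B u v.
Proof. by rewrite -[a *: u]addr0 (bilin_l hB) bilin0l addr0. Qed.

Lemma bilinZr a u v : B u (a *: v) = a * B u v.
Proof. by rewrite -[a *: v]addr0 (bilin_r hB) bilin0r addr0. Qed.

Lemma bilinNl u v : B (- u) v = - B u v.
Proof. by rewrite -scaleN1r bilinZl mulN1r. Qed.

Lemma bilinNr u v : B u (- v) = - B u v.
Proof. by rewrite -scaleN1r bilinZr mulN1r. Qed.

Lemma bilin_suml (I : Type) (r : seq I) (F : I -> 'rV[R]_m) v :
  B (\sum_(i <- r) F i) v = \sum_(i <- r) B (F i) v.
Proof.
by elim: r => [|i r IH]; rewrite ?big_nil ?bilin0l// !big_cons bilinDl IH.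
Qed.

Lemma bilin_sumr (I : Type) (r : seq I) (F : I -> 'rV[R]_m) v :
  B v (\sum_(i <- r) F i) = \sum_(i <- r) B v (F i).
Proof.
by elim: r => [|i r IH]; rewrite ?big_nil ?bilin0r// !big_cons bilinDr IH.
Qed.

End bilinear.

Record inner_product B : Prop := InnerProduct {
  ip_bilin :> bilinear_form B;
  ip_sym : forall u v, B u v = B v u;
  ip_pos : forall u, u != 0 -> 0 < B u u }.

Lemma ip_inj B u v : inner_product B -> (forall w, B u w = B v w) -> u = v.
Proof.
move=> hB uv; apply/eqP; rewrite -subr_eq0; apply/negPn/negP => /(ip_pos hB).
by rewrite (bilinDl hB) (bilinNl hB) uv subrr ltxx.
Qed.

Definition orthonormal B (e : 'I_m -> 'rV[R]_m) :=
  forall i j, B (e i) (e j) = (i == j)%:R.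

(** Orthonormality reads [F *m E^T = 1]. For square matrices a one-sided inverse is two-sided, and
    the reversed product [E^T *m F = 1] is the expansion of the standard basis. *)
Lemma orthonormal_expand B e v : inner_product B -> orthonormal B e ->
  v = \sum_i B (e i) v *: e i.
Proof.
move=> hB oe; pose E : 'M[R]_m := \matrix_(i, j) e i 0 j.
pose F : 'M[R]_m := \matrix_(i, j) B (e i) (delta_mx 0 j).
have FE : F *m E^T = 1%:M.
  apply/matrixP => i j; rewrite !mxE -oe [e j in RHS]row_sum_delta.
  rewrite (bilin_sumr hB); apply: eq_bigr => k _.
  by rewrite !mxE (bilinZr hB) mulrC.
have /matrixP EF := mulmx1C FE.
apply/rowP => j; rewrite summxE -[LHS]mulr1.
rewrite [v in RHS]row_sum_delta.
under eq_bigr => i _ do rewrite mxE (bilin_sumr hB) mulr_suml.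
rewrite exchange_big /= (bigD1 j)//= [X in _ + X]big1 ?addr0.
  have := EF j j; rewrite !mxE eqxx => E1; rewrite -[1]E1 mulr_sumr.
  by apply: eq_bigr => i _; rewrite !mxE (bilinZr hB); ring.
move=> k kj; have := congr1 ( *%R (v 0 k)) (EF j k).
rewrite !mxE eq_sym (negbTE kj) mulr0 mulr_sumr => E0; rewrite -[RHS]E0.
by apply: eq_bigr => i _; rewrite !mxE (bilinZr hB); ring.
Qed.

Lemma parseval B e u v : inner_product B -> orthonormal B e ->
  B u v = \sum_i B (e i) u * B (e i) v.
Proof.
move=> hB oe; rewrite {1}(orthonormal_expand u hB oe) (bilin_suml hB).
by apply: eq_bigr => i _; rewrite (bilinZl hB).
Qed.

(** After each [e i] is expanded in [e'], [parseval] sums the coefficients over [i] to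
    [B (e' j) (e' k)], a Kronecker delta. *)
Lemma trace_orthonormal B e e' (T : 'rV[R]_m -> 'rV[R]_m -> R) :
    inner_product B -> orthonormal B e -> orthonormal B e' -> bilinear_form T ->
  \sum_i T (e i) (e i) = \sum_i T (e' i) (e' i).
Proof.
move=> hB oe oe' hT.
have -> : \sum_i T (e i) (e i) =
    \sum_i \sum_j \sum_k B (e i) (e' j) * B (e i) (e' k) * T (e' j) (e' k).
  apply: eq_bigr => i _; rewrite {1 2}(orthonormal_expand (e i) hB oe').
  rewrite (bilin_suml hT); apply: eq_bigr => j _.
  rewrite (bilin_sumr hT); apply: eq_bigr => k _.
  by rewrite (bilinZl hT) (bilinZr hT) mulrA !(ip_sym hB (e i)).
rewrite exchange_big; apply: eq_bigr => j _; rewrite exchange_big /= (bigD1 j)//=.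
rewrite [X in _ + X]big1 => [|k kj]; rewrite -mulr_suml -parseval// oe'.
  by rewrite eqxx mul1r addr0.
by rewrite eq_sym (negbTE kj) mul0r.
Qed.

End inner_products.

(** * Smoothness is a local property *)

Section locality.
Context (R : realType).

Lemma Ck_local (V W : normedModType R) k (U : set V) (f : V -> W) :
  (forall x, U x -> exists2 U', U' x & Ck k U' f) -> Ck k U f.
Proof.
elim: k f => [|k IH] f loc.
  by move=> x /loc[U' Ux]; exact.
split=> [x /loc[U' Ux [df _]]|v]; first exact: df.
by apply: IH => x /loc[U' Ux [_ Df]]; exists U' => //; exact: Df.
Qed.

Lemma smooth_vf_local m (M : manifold R m) (U : set M) X :
  (forall p, U p -> exists2 U', U' p & smooth_vf U' X) -> smooth_vf U X.
Proof.
move=> loc c ac k; apply: Ck_local => _ [p [cp Up] <-].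
have [U' U'p sX] := loc p Up.
by exists (c @` (cdom c `&` U')); [exists p|exact: sX].
Qed.

End locality.

Section metric.
Context (R : realType) (m : nat) (M : manifold R m) (g : metric M).
Hypothesis hg : riemannian g.
Implicit Types (p q : M) (U : set M) (u v w x y z : 'rV[R]_m).
Implicit Types (X Y Z W : M -> 'rV[R]_m) (f h : M -> R).

Lemma riemannian_ip p : inner_product (g p).
Proof.
refine (InnerProduct (BilinearForm (metric_linear hg p) _) (Defs.metric_sym hg p)
  (metric_pos hg p)).
by move=> a u v w; rewrite !(Defs.metric_sym hg p u) (metric_linear hg).
Qed.

Lemma ddir_sum (U : set M) p f (I : Type) (r : seq I) (a : I -> R)
    (v : I -> 'rV[R]_m) : smooth_fun U f -> U p ->
  ddir p (\sum_(i <- r) a i *: v i) f = \sum_(i <- r) a i * ddir p (v i) f.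
Proof.
move=> sf Up; elim: r => [|i r IH]; last first.
  by rewrite !big_cons (ddir_linear _ _ _ sf Up) IH.
rewrite !big_nil; have := ddir_linear 1 0 0 sf Up.
rewrite scale1r addr0 mul1r -[X in X = _]addr0 => /addrI E; exact: esym E.
Qed.

Section gradient.
Context (f : M -> R) (U : set M) (oU : open U) (sf : smooth_fun U f) (p0 : M).
Let D := cdom (chart_at p0).
Let E i := coord_vf p0 (delta_mx 0 i : 'rV[R]_m).
(** The Gram matrix of the coordinate frame. In this frame the coefficients [a] of the gradient
    solve [a *m G = b], the classical formula with the inverse metric; it provides what the choice
    by [get] does not, existence and smooth dependence on the point. *)
Let G q : 'M[R]_m := \matrix_(i, j) g q (E i q) (E j q).
Let b q : 'rV[R]_m := \row_j ddir q (E j q) f.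
Let a q := b q *m invmx (G q).
Let w q := \sum_i (a q) 0 i *: E i q.

(** A row in the kernel of [G] gives a vector orthogonal to the whole frame. That vector is zero by
    nondegeneracy, and so are its components, which form the row. *)
Let G_unit q : D q -> G q \in unitmx.
Proof.
move=> Dq; have ip := riemannian_ip q; have ap := chart_at_atlas p0.
rewrite -row_free_unit -kermx_eq0; apply/rowV0P => u /sub_kermxP uG.
set v := \sum_i u 0 i *: E i q.
have gv j : g q v (E j q) = 0.
  have /rowP/(_ j) := uG; rewrite !mxE => uGj.
  rewrite (bilin_suml ip) -[RHS]uGj.
  by apply: eq_bigr => i _; rewrite (bilinZl ip) mxE.
have v0 : v = 0.
  apply: (ip_inj ip) => y; rewrite (bilin0l ip) (coord_vf_expand y Dq).
  by rewrite (bilin_sumr ip) big1// => j _; rewrite (bilinZr ip) gv mulr0.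
rewrite (row_sum_delta u); transitivity (tcoord (chart_at p0) q v).
  rewrite tcoord_sum//; apply: eq_bigr => i _.
  by rewrite tcoordZ// tcoord_coord_vf_self.
by have := tcoordZ 0 0 ap Dq; rewrite !scale0r v0.
Qed.

Let wP q v : D q -> U q -> g q (w q) v = ddir q v f.
Proof.
move=> Dq Uq; have ip := riemannian_ip q.
have wE j : g q (w q) (E j q) = ddir q (E j q) f.
  rewrite (bilin_suml ip); transitivity ((a q *m G q) 0 j).
    by rewrite mxE; apply: eq_bigr => i _; rewrite (bilinZl ip) [G q i j]mxE.
  by rewrite /a mulmxKV ?G_unit// mxE.
rewrite (coord_vf_expand v Dq) (bilin_sumr ip) (ddir_sum _ _ _ sf Uq).
by apply: eq_bigr => j _; rewrite (bilinZr ip) wE.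
Qed.

Let w_smooth : smooth_vf (U `&` D) w.
Proof.
have oD : open D by exact: atlas_open (chart_at_atlas p0).
have oUD := openI oU oD.
have sE i : smooth_vf (U `&` D) (E i).
  by apply: smooth_vf_sub (smooth_coord_vf _ _) => ? [].
have sf' : smooth_fun (U `&` D) f by apply: smooth_fun_sub sf => ? [].
apply: (smooth_vf_sum _ oUD) => i; apply: (smooth_vfZ oUD _ (sE i)) => c ac k.
have oc := chart_img_open ac oUD.
have Cb : Ck k (c @` (cdom c `&` (U `&` D))) (b \o cinv c).
  apply/(Ck_mxP k _ oc) => i0 j; apply: Ck_ext (smooth_ddir oUD (sE j) sf' ac k) => //.
  by move=> x _; rewrite /= mxE.
have CG : Ck k (c @` (cdom c `&` (U `&` D))) (G \o cinv c).
  apply/(Ck_mxP k _ oc) => i0 j.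
  apply: Ck_ext (metric_smooth hg oUD (sE i0) (sE j) ac k) => //.
  by move=> x _; rewrite /= mxE.
have uG x : (c @` (cdom c `&` (U `&` D))) x -> (G \o cinv c) x \in unitmx.
  by move=> /(chart_img_inv ac)[_ [_ Dx] _]; exact: G_unit.
have Ca := Ck_mulmx oc Cb (Ck_invmx oc uG CG).
exact: (Ck_mxP k _ oc).1 Ca 0 i.
Qed.

Let grad_ex q : D q -> U q -> exists u, forall v, g q u v = ddir q v f.
Proof. by move=> Dq Uq; exists (w q) => v; exact: wP. Qed.

Let grad_wE q : D q -> U q -> grad g f q = w q.
Proof.
move=> Dq Uq; apply: (ip_inj (riemannian_ip q)) => v.
by rewrite wP//; have /getPex := grad_ex Dq Uq; exact.
Qed.

Lemma gradP_chart q v : D q -> U q -> g q (grad g f q) v = ddir q v f.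
Proof. by move=> Dq Uq; rewrite grad_wE// wP. Qed.

Lemma smooth_grad_chart : smooth_vf (U `&` D) (grad g f).
Proof.
have oD : open D by exact: atlas_open (chart_at_atlas p0).
apply: smooth_vf_ext w_smooth; first exact: openI.
by move=> q [Uq Dq]; rewrite grad_wE.
Qed.

End gradient.

Lemma gradP U f q v : open U -> smooth_fun U f -> U q ->
  g q (grad g f q) v = ddir q v f.
Proof. by move=> oU sf Uq; exact: (gradP_chart sf v (chart_at_dom q) Uq). Qed.

Lemma smooth_grad U f : open U -> smooth_fun U f -> smooth_vf U (grad g f).
Proof.
move=> oU sf; apply: smooth_vf_local => p Up.
exists (U `&` cdom (chart_at p)); last exact: smooth_grad_chart.
by split=> //; exact: chart_at_dom.
Qed.

Context (nabla : affine_connection M).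
Hypothesis hL : levi_civita g nabla.

(** Differentiate [g(grad f, Y) = Y f] along [X]. The Hessian becomes [X (Y f) - (nabla_X Y) f],
    which contains derivatives of [f] only. *)
Lemma nabla_grad U X Y f p : open U -> U p -> smooth_fun U f ->
    smooth_vf U X -> smooth_vf U Y ->
  g p (nabla X (grad g f) p) (Y p) =
  ddir p (X p) (fun q => ddir q (Y q) f) - ddir p (nabla X Y p) f.
Proof.
move=> oU Up sf sX sY; have sG := smooth_grad oU sf.
have C := levi_civita_metric hL oU sX sG sY Up.
have E : ddir p (X p) (fun q => g q (grad g f q) (Y q)) =
    ddir p (X p) (fun q => ddir q (Y q) f).
  by apply: (ddir_ext (U := U)) => // q Uq; exact: gradP oU sf Uq.
by rewrite -E C (gradP _ oU sf Up) addrK.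
Qed.

(** By [nabla_grad] the antisymmetric part is the bracket minus the torsion-free difference of
    covariant derivatives, both applied to [f]. *)
Lemma Hess_sym U f p x y : open U -> U p -> smooth_fun U f ->
  Hess g nabla f p x y = Hess g nabla f p y x.
Proof.
move=> oU Up; set U' := U `&` cdom (chart_at p).
have oU' : open U' by apply: openI => //; exact: atlas_open (chart_at_atlas p).
have Up' : U' p by split=> //; exact: chart_at_dom.
have sE v : smooth_vf U' (coord_vf p v).
  by apply: smooth_vf_sub (smooth_coord_vf _ _) => ? [].
move=> sf; have {}sf : smooth_fun U' f by apply: smooth_fun_sub sf => ? [].
have H v w : Hess g nabla f p v w =
    ddir p v (fun q => ddir q (coord_vf p w q) f) -
    ddir p (nabla (coord_vf p v) (coord_vf p w) p) f.
  have := nabla_grad oU' Up' sf (sE v) (sE w).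
  by rewrite !coord_vf_at.
have T := levi_civita_torsion hL oU' (sE x) (sE y) Up'.
have S := ddir_bracket oU' Up' (sE x) (sE y) sf.
move: S; rewrite -T !coord_vf_at -[X in ddir p X f]addrC -scaleN1r.
rewrite (ddir_linear _ _ _ sf Up') !H.
have swap (a b c d : R) : -1 * d + c = a - b -> a - c = b - d by lra.
exact: swap.
Qed.

Lemma Rm_atE p w z x y : Rm_at g nabla p w z x y = g p w (curv_at nabla p x y z).
Proof. by rewrite /Rm_at /Rm coord_vf_at. Qed.

End metric.

(** * Lifts to the product *)

Section lifts.
Context (R : realType) (m1 m2 : nat) (M1 : manifold R m1) (M2 : manifold R m2).
Local Notation MM := (prod_manifold M1 M2).

Lemma derive_row_fun a b c d (f : 'rV[R]_a -> 'rV[R]_c)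
    (h : 'rV[R]_b -> 'rV[R]_d) (x v : 'rV[R]_(a + b)) :
    differentiable f (lsubmx x) -> differentiable h (rsubmx x) ->
  'D_v (row_fun f h) x =
  row_mx ('D_(lsubmx v) f (lsubmx x)) ('D_(rsubmx v) h (rsubmx x)).
Proof.
move=> df dh; have [dF eF] := diff_row_fun df dh.
by rewrite deriveE// eF /row_fun deriveE// deriveE.
Qed.

Lemma derive_prod_chart (c1 d1 : chart R M1 m1) (c2 d2 : chart R M2 m2) p q u v :
    atlas c1 -> atlas d1 -> atlas c2 -> atlas d2 ->
    cdom c1 p -> cdom d1 p -> cdom c2 q -> cdom d2 q ->
  'D_(row_mx u v) (prod_chart d1 d2 \o cinv (prod_chart c1 c2))
    (prod_chart c1 c2 (p, q)) =
  row_mx ('D_u (d1 \o cinv c1) (c1 p)) ('D_v (d2 \o cinv c2) (c2 q)).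
Proof.
move=> ac1 ad1 ac2 ad2 c1p d1p c2q d2q.
have := @derive_row_fun _ _ _ _ (d1 \o cinv c1) (d2 \o cinv c2)
  (row_mx (c1 p) (c2 q)) (row_mx u v).
rewrite !row_mxKl !row_mxKr; apply; exact: transition_diff.
Qed.

Lemma tcoord_prod (c1 : chart R M1 m1) (c2 : chart R M2 m2) p q u v :
    atlas c1 -> atlas c2 -> cdom c1 p -> cdom c2 q ->
  @tcoord R (m1 + m2) MM (prod_chart c1 c2) (p, q) (row_mx u v) =
  row_mx (tcoord c1 p u) (tcoord c2 q v).
Proof.
move=> ac1 ac2 c1p c2q; apply: derive_prod_chart => //.
- exact: chart_at_atlas.
- exact: chart_at_atlas.
- exact: chart_at_dom.
- exact: chart_at_dom.
Qed.

(** Unlike in [vf_pair], each component depends on the point of its own factor only. *)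
Definition lift (X1 : M1 -> 'rV[R]_m1) (X2 : M2 -> 'rV[R]_m2) :
  MM -> 'rV[R]_(m1 + m2) := fun x => row_mx (X1 x.1) (X2 x.2).

Lemma cdom_prod_setI (c1 : chart R M1 m1) (c2 : chart R M2 m2)
    (U1 : set M1) (U2 : set M2) :
  cdom (prod_chart c1 c2) `&` (U1 `*` U2) =
  (cdom c1 `&` U1) `*` (cdom c2 `&` U2).
Proof. by apply/seteqP; split=> -[p q] [[? ?] [? ?]]. Qed.

Section lift_fields.
Context (U1 : set M1) (U2 : set M2) (oU1 : open U1) (oU2 : open U2).
Let U : set MM := U1 `*` U2.

Lemma open_prod : open U.
Proof. exact: open_setX. Qed.

Lemma vf_in_lift (c1 : chart R M1 m1) (c2 : chart R M2 m2) X1 X2 a :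
    atlas c1 -> atlas c2 ->
    (prod_chart c1 c2 @` (cdom (prod_chart c1 c2) `&` U)) a ->
  @vf_in R (m1 + m2) MM (prod_chart c1 c2) (lift X1 X2) a =
  row_fun (vf_in c1 X1) (vf_in c2 X2) a.
Proof.
move=> ac1 ac2; rewrite cdom_prod_setI prod_chart_image.
move=> [/(chart_img_inv ac1)[ca _ _] /(chart_img_inv ac2)[cb _ _]].
exact: tcoord_prod.
Qed.

Lemma smooth_lift X1 X2 : smooth_vf U1 X1 -> smooth_vf U2 X2 ->
  smooth_vf U (lift X1 X2).
Proof.
move=> s1 s2 c [c1 [c2 [ac1 ac2 ->]]] k.
have o1 := chart_img_open ac1 oU1; have o2 := chart_img_open ac2 oU2.
have := Ck_row_fun o1 o2 (s1 _ ac1 k) (s2 _ ac2 k).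
rewrite -prod_chart_image -cdom_prod_setI => C; apply: Ck_ext C.
  rewrite cdom_prod_setI prod_chart_image; exact: open_row_set.
by move=> a Ia; rewrite vf_in_lift.
Qed.

Lemma smooth_fst f : smooth_fun U1 f -> smooth_fun U (fun x : MM => f x.1).
Proof.
move=> sf c [c1 [c2 [ac1 ac2 ->]]] k.
have o1 := chart_img_open ac1 oU1; have o2 := chart_img_open ac2 oU2.
rewrite cdom_prod_setI prod_chart_image.
set V := [set _ | _]; have oV : open V by exact: open_row_set.
have Cl : Ck k V (lsubmx : 'rV[R]_(m1 + m2) -> 'rV[R]_m1).
  apply/(Ck_mxP k _ oV) => i j; rewrite (ord1 i).
  by apply: Ck_ext (Ck_coord k (lshift m2 j) oV) => // x _; rewrite mxE.
have Vl x : V x -> (c1 @` (cdom c1 `&` U1)) (lsubmx x) by case.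
exact: Ck_comp_real oV o1 Vl Cl (sf _ ac1 k).
Qed.

Lemma smooth_snd f : smooth_fun U2 f -> smooth_fun U (fun x : MM => f x.2).
Proof.
move=> sf c [c1 [c2 [ac1 ac2 ->]]] k.
have o1 := chart_img_open ac1 oU1; have o2 := chart_img_open ac2 oU2.
rewrite cdom_prod_setI prod_chart_image.
set V := [set _ | _]; have oV : open V by exact: open_row_set.
have Cr : Ck k V (rsubmx : 'rV[R]_(m1 + m2) -> 'rV[R]_m2).
  apply/(Ck_mxP k _ oV) => i j; rewrite (ord1 i).
  by apply: Ck_ext (Ck_coord k (rshift m1 j) oV) => // x _; rewrite mxE.
have Vr x : V x -> (c2 @` (cdom c2 `&` U2)) (rsubmx x) by case.
exact: Ck_comp_real oV o2 Vr Cr (sf _ ac2 k).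
Qed.

(** In a product chart a lift is a [row_fun], whose derivative is block diagonal, so no cross terms
    arise. *)
Lemma bracket_lift X1 X2 Y1 Y2 p q : U1 p -> U2 q ->
    smooth_vf U1 X1 -> smooth_vf U1 Y1 -> smooth_vf U2 X2 -> smooth_vf U2 Y2 ->
  bracket (lift X1 X2) (lift Y1 Y2) (p, q) =
  row_mx (bracket X1 Y1 p) (bracket X2 Y2 q).
Proof.
move=> Up Uq sX1 sY1 sX2 sY2.
have [a1 a2] := (chart_at_atlas p, chart_at_atlas q).
have [d1 d2] := (chart_at_dom p, chart_at_dom q).
set c1 := chart_at p in a1 d1; set c2 := chart_at q in a2 d2.
set V := prod_chart c1 c2 @` (cdom (prod_chart c1 c2) `&` U).
have oV : open V.
  by rewrite /V cdom_prod_setI prod_chart_image; apply: open_row_set;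
    exact: chart_img_open.
have Vx : V (row_mx (c1 p) (c2 q)) by exists (p, q).
have D A1 A2 B1 B2 : smooth_vf U1 B1 -> smooth_vf U2 B2 ->
    'D_(lift A1 A2 (p, q)) (@vf_in R (m1 + m2) MM (prod_chart c1 c2) (lift B1 B2))
      (row_mx (c1 p) (c2 q)) =
    row_mx ('D_(A1 p) (vf_in c1 B1) (c1 p)) ('D_(A2 q) (vf_in c2 B2) (c2 q)).
  move=> sB1 sB2; have E1 := smooth_vf_diff sB1 a1 d1 Up.
  have E2 := smooth_vf_diff sB2 a2 d2 Uq.
  have := @derive_row_fun _ _ _ _ (vf_in c1 B1) (vf_in c2 B2)
    (row_mx (c1 p) (c2 q)) (row_mx (A1 p) (A2 q)).
  rewrite !row_mxKl !row_mxKr => /(_ E1 E2) <-.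
  by apply: derive_ext oV Vx _ => a Va; exact: vf_in_lift.
have E1 := D X1 X2 Y1 Y2 sY1 sY2; have E2 := D Y1 Y2 X1 X2 sX1 sX2.
refine (etrans (congr2 (fun a b => a - b) E1 E2) _).
by rewrite opp_row_mx add_row_mx.
Qed.

End lift_fields.

Lemma derive_lsubmx (F : 'rV[R]_m1 -> R) (x v : 'rV[R]_(m1 + m2)) :
  'D_v (F \o lsubmx) x = 'D_(lsubmx v) F (lsubmx x).
Proof.
rewrite /derive; set f := fun h => _; set h := fun h => _.
suff -> : f = h by [].
apply/funext => t; rewrite /f /h /=; congr (_ *: (F _ - _)).
by apply/rowP => i; rewrite !mxE.
Qed.

Lemma derive_rsubmx (F : 'rV[R]_m2 -> R) (x v : 'rV[R]_(m1 + m2)) :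
  'D_v (F \o rsubmx) x = 'D_(rsubmx v) F (rsubmx x).
Proof.
rewrite /derive; set f := fun h => _; set h := fun h => _.
suff -> : f = h by [].
apply/funext => t; rewrite /f /h /=; congr (_ *: (F _ - _)).
by apply/rowP => i; rewrite !mxE.
Qed.

Lemma ddir_fst p q u v (f : M1 -> R) :
  @ddir R (m1 + m2) MM (p, q) (row_mx u v) (fun x : MM => f x.1) = ddir p u f.
Proof.
have := derive_lsubmx (f \o cinv (chart_at p))
  (row_mx (chart_at p p) (chart_at q q)) (row_mx u v).
by rewrite !row_mxKl.
Qed.

Lemma ddir_snd p q u v (f : M2 -> R) :
  @ddir R (m1 + m2) MM (p, q) (row_mx u v) (fun x : MM => f x.2) = ddir q v f.
Proof.
have := derive_rsubmx (f \o cinv (chart_at q))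
  (row_mx (chart_at p p) (chart_at q q)) (row_mx u v).
by rewrite !row_mxKr.
Qed.

End lifts.

(** * The warped product *)

(* The algebra behind the uniqueness of the Levi-Civita connection. *)
Lemma sym_antisym_eq0 (R : realType) (T : Type) (P : T -> Prop)
    (d : T -> T -> T -> R) :
    (forall x y z, P x -> P y -> P z -> d x y z = d y x z) ->
    (forall x y z, P x -> P y -> P z -> d x y z = - d x z y) ->
  forall x y z, P x -> P y -> P z -> d x y z = 0.
Proof.
move=> ds da x y z Px Py Pz.
have E : d x y z = - d x y z.
  rewrite {1}(da x y z)// (ds x z y)// (da z x y)// (ds z y x)// (da y z x)//.
  by rewrite (ds y x z)// !opprK.
by lra.
Qed.

(** * Bilinearity of the curvature tensor in pairs of slots *)

Section Rm_at_forms.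
Context (R : realType) (m : nat) (M : manifold R m) (g : metric M)
  (nabla : affine_connection M).
Hypothesis torsion_free : forall U X Y, open U -> smooth_vf U X ->
  smooth_vf U Y -> forall p, U p ->
  nabla X Y p - nabla Y X p = bracket X Y p.
Context (p : M).
Hypothesis ip : inner_product (g p).
Implicit Types (u v w x y z : 'rV[R]_m).

(** Slots 1 and 3 are the ones contracted in [Ric]; slots 2 and 4, treated next, are its arguments
    and are contracted in [Scal]. *)
Lemma Rm_at_bilin13 z y :
  bilinear_form (fun w x => Rm_at g nabla p w z x y).
Proof.
split=> [a u v x|a w x x']; rewrite !Rm_atE.
  by rewrite (bilin_l ip).
by rewrite (curv_at_linearl torsion_free) (bilin_r ip).
Qed.

Lemma Rm_at_bilin24 w x :
  bilinear_form (fun z y => Rm_at g nabla p w z x y).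
Proof.
split=> [a z z' y|a z y y']; rewrite !Rm_atE.
  by rewrite (curv_at_linearr torsion_free) (bilin_r ip).
by rewrite (curv_at_linearm torsion_free) (bilin_r ip).
Qed.

Lemma Ric_bilin (e : 'I_m -> 'rV[R]_m) : bilinear_form (Ric g nabla p e).
Proof.
split=> [a u v y|a x u v]; rewrite /Ric mulr_sumr -big_split;
  apply: eq_bigr => i _.
  by rewrite (bilin_l (Rm_at_bilin24 (e i) (e i))).
by rewrite (bilin_r (Rm_at_bilin24 (e i) (e i))).
Qed.

End Rm_at_forms.

Section warped_product.
Context (R : realType) (m1 m2 : nat) (M1 : manifold R m1) (M2 : manifold R m2)
  (g1 : metric M1) (g2 : metric M2) (lam : M1 -> R).
Local Notation MM := (prod_manifold M1 M2).
Context (D1 : affine_connection M1) (D2 : affine_connection M2)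
  (D : affine_connection MM).
Hypotheses (hg1 : riemannian g1) (hg2 : riemannian g2)
  (lam_smooth : smooth_fun setT lam) (lam_gt0 : forall p, 0 < lam p)
  (hD1 : levi_civita g1 D1) (hD2 : levi_civita g2 D2)
  (hD : levi_civita (warped g1 g2 lam) D).
Local Notation gw := (warped g1 g2 lam).
Local Notation grad_lam := (grad g1 lam).

Let ip1 p := riemannian_ip hg1 p.
Let ip2 q := riemannian_ip hg2 q.

Lemma warpedE p q u1 u2 v1 v2 :
  gw (p, q) (row_mx u1 u2) (row_mx v1 v2) =
  g1 p u1 v1 + lam p ^+ 2 * g2 q u2 v2.
Proof. by rewrite /warped !row_mxKl !row_mxKr. Qed.

Lemma warped_ip x : inner_product (gw x).
Proof.
case: x => p q; have lamp : 0 < lam p ^+ 2 by rewrite exprn_gt0.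
have sym u v : gw (p, q) u v = gw (p, q) v u.
  by rewrite /warped (ip_sym (ip1 _)) (ip_sym (ip2 _)).
have lin a u v w : gw (p, q) (a *: u + v) w = a * gw (p, q) u w + gw (p, q) v w.
  rewrite -(hsubmxK u) -(hsubmxK v) -(hsubmxK w) scale_row_mx add_row_mx !warpedE.
  by rewrite (bilin_l (ip1 p)) (bilin_l (ip2 q)); ring.
split; [split=> // a u v w|by []|move=> u u0].
  by rewrite !(sym u) lin.
rewrite -(hsubmxK u) warpedE.
have nneg1 v : 0 <= g1 p v v.
  have [->|v0] := eqVneq v 0; first by rewrite (bilin0l (ip1 p)).
  exact: ltW (ip_pos (ip1 p) v0).
have nneg2 v : 0 <= g2 q v v.
  have [->|v0] := eqVneq v 0; first by rewrite (bilin0l (ip2 q)).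
  exact: ltW (ip_pos (ip2 q) v0).
have [l0|l0] := eqVneq (lsubmx u) 0; last first.
  exact: ltr_wpDr (mulr_ge0 (ltW lamp) (nneg2 _)) (ip_pos (ip1 p) l0).
have [r0|r0] := eqVneq (rsubmx u) 0; last first.
  exact: ltr_wpDl (nneg1 _) (mulr_gt0 lamp (ip_pos (ip2 q) r0)).
by move: u0; rewrite -(hsubmxK u) l0 r0 row_mx0 eqxx.
Qed.

(** The coefficients are those of the Koszul formula. Half the derivative of the weight [lam^2] is
    [lam] times that of [lam]; it acts as a gradient in the first factor, and is divided by the
    weight in the second. *)
Definition warped_covd (X Y : (M1 -> 'rV[R]_m1) * (M2 -> 'rV[R]_m2)) p q :=
  row_mx
    (D1 X.1 Y.1 p - (lam p * g2 q (X.2 q) (Y.2 q)) *: grad_lam p)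
    (D2 X.2 Y.2 q + (ddir p (X.1 p) lam / lam p) *: Y.2 q
      + (ddir p (Y.1 p) lam / lam p) *: X.2 q).

Local Notation field := ((M1 -> 'rV[R]_m1) * (M2 -> 'rV[R]_m2))%type.
Local Notation liftf X := (lift X.1 X.2).

(** * The Levi-Civita connection on lifts *)

Section on_open.
Context (U1 : set M1) (U2 : set M2) (oU1 : open U1) (oU2 : open U2).
Local Notation U := (U1 `*` U2 : set MM).
Let oU : open U := open_prod oU1 oU2.

Definition smooth_pair (X : field) := smooth_vf U1 X.1 /\ smooth_vf U2 X.2.

Let smooth_liftf X : smooth_pair X -> smooth_vf U (liftf X).
Proof. by move=> [? ?]; exact: smooth_lift. Qed.

Let slam1 : smooth_fun U1 lam.
Proof. exact: smooth_fun_sub lam_smooth. Qed.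

Let slam : smooth_fun U (fun x : MM => lam x.1).
Proof. exact: smooth_fst. Qed.

Let gradE p v : U1 p -> g1 p (grad_lam p) v = ddir p v lam.
Proof. exact: gradP. Qed.

(** The derivative [2 lam X1(lam)] of the weight is shared equally by the two terms on the right.
    The gradient term of each cancels the [X2] term of the other. *)
Lemma warped_covd_metric X Y Z p q : U1 p -> U2 q ->
    smooth_pair X -> smooth_pair Y -> smooth_pair Z ->
  ddir ((p, q) : MM) (liftf X (p, q)) (fun x => gw x (liftf Y x) (liftf Z x)) =
  gw (p, q) (warped_covd X Y p q) (liftf Z (p, q)) +
  gw (p, q) (liftf Y (p, q)) (warped_covd X Z p q).
Proof.
move=> Up Uq [sX1 sX2] [sY1 sY2] [sZ1 sZ2].
have Ux : U (p, q) by [].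
have sF1 := metric_smooth hg1 oU1 sY1 sZ1.
have sF2 := metric_smooth hg2 oU2 sY2 sZ2.
have sF1' := smooth_fst oU1 oU2 sF1; have sF2' := smooth_snd oU1 oU2 sF2.
have sl2 := smooth_funM oU slam slam.
rewrite (ddir_ext (h := fun x : MM => g1 x.1 (Y.1 x.1) (Z.1 x.1) +
  (lam x.1 * lam x.1) * g2 x.2 (Y.2 x.2) (Z.2 x.2)) _ oU Ux); last first.
  by move=> [p' q'] _; rewrite warpedE expr2.
rewrite (ddirD _ sF1' (smooth_funM oU sl2 sF2') Ux) (ddirM _ sl2 sF2' Ux).
rewrite (ddirM _ slam slam Ux) /lift /=.
rewrite (ddir_fst _ _ _ _ (fun p => g1 p (Y.1 p) (Z.1 p))).
rewrite (ddir_snd _ _ _ _ (fun q => g2 q (Y.2 q) (Z.2 q))) ddir_fst.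
rewrite (levi_civita_metric hD1 oU1 sX1 sY1 sZ1 Up).
rewrite (levi_civita_metric hD2 oU2 sX2 sY2 sZ2 Uq).
rewrite /warped_covd !warpedE.
rewrite (bilinDl (ip1 p)) (bilinNl (ip1 p)) (bilinZl (ip1 p)) (gradE _ Up).
rewrite (bilinDr (ip1 p)) (bilinNr (ip1 p)) (bilinZr (ip1 p)).
rewrite (ip_sym (ip1 p) _ (grad_lam p)) (gradE _ Up).
rewrite !(bilinDl (ip2 q)) !(bilinZl (ip2 q)) !(bilinDr (ip2 q)) !(bilinZr (ip2 q)).
rewrite (ip_sym (ip2 q) _ (X.2 q)).
have := lt0r_neq0 (lam_gt0 p).
move: (lam p) (ddir p (X.1 p) lam) (ddir p (Y.1 p) lam) (ddir p (Z.1 p) lam).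
move: (g1 p (D1 _ _ p) _) (g1 p _ (D1 _ _ p)) => a b l lx ly lz.
move: (g2 q (D2 _ _ q) _) (g2 q _ (D2 _ _ q)) => c d.
move: (g2 q (Y.2 q) (Z.2 q)) (g2 q (X.2 q) (Z.2 q)) (g2 q (X.2 q) (Y.2 q)).
by move=> e f h l0; field.
Qed.

Lemma warped_covd_test X Y Z p q : U1 p -> U2 q ->
    smooth_pair X -> smooth_pair Y -> smooth_pair Z ->
  gw (p, q) (D (liftf X) (liftf Y) (p, q) - warped_covd X Y p q)
    (liftf Z (p, q)) = 0.
Proof.
move=> Up Uq sX sY sZ; have Ux : U (p, q) by [].
have ip := warped_ip (p, q).
pose d (X Y Z : field) :=
  gw (p, q) (D (liftf X) (liftf Y) (p, q) - warped_covd X Y p q) (liftf Z (p, q)).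
have dE X' Y' Z' : d X' Y' Z' = gw (p, q) (D (liftf X') (liftf Y') (p, q))
    (liftf Z' (p, q)) - gw (p, q) (warped_covd X' Y' p q) (liftf Z' (p, q)).
  by rewrite /d (bilinDl ip) (bilinNl ip).
have ds X' Y' Z' : smooth_pair X' -> smooth_pair Y' -> smooth_pair Z' ->
    d X' Y' Z' = d Y' X' Z'.
  move=> sX' sY' sZ'; rewrite /d; congr (gw _ _ _).
  have T := levi_civita_torsion hD oU (smooth_liftf sX') (smooth_liftf sY') Ux.
  have [[sX1 sX2] [sY1 sY2]] := (sX', sY').
  have T1 := levi_civita_torsion hD1 oU1 sX1 sY1 Up.
  have T2 := levi_civita_torsion hD2 oU2 sX2 sY2 Uq.
  move: T; rewrite (bracket_lift oU1 oU2 Up Uq)// -T1 -T2 => T.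
  apply/eqP; rewrite subr_eq -addrA addrC -subr_eq addrC T; apply/eqP.
  rewrite /warped_covd opp_row_mx add_row_mx.
  rewrite (ip_sym (ip2 q) (Y'.2 q)); congr row_mx.
    by apply/rowP => i; rewrite !mxE; ring.
  by apply/rowP => i; rewrite !mxE; ring.
have da X' Y' Z' : smooth_pair X' -> smooth_pair Y' -> smooth_pair Z' ->
    d X' Y' Z' = - d X' Z' Y'.
  move=> sX' sY' sZ'; rewrite !dE.
  have C := levi_civita_metric hD oU (smooth_liftf sX') (smooth_liftf sY')
    (smooth_liftf sZ') Ux.
  move: C; rewrite (warped_covd_metric Up Uq sX' sY' sZ').
  rewrite (ip_sym ip (liftf Y' (p, q))) (ip_sym ip (liftf Y' (p, q))).
  have aux (a b c e : R) : a + b = c + e -> c - a = - (e - b) by lra.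
  exact: aux.
exact: sym_antisym_eq0 ds da _ _ _ sX sY sZ.
Qed.

End on_open.

Lemma warped_covdE U1 U2 X Y p q : open U1 -> open U2 -> U1 p -> U2 q ->
    smooth_pair U1 U2 X -> smooth_pair U1 U2 Y ->
  D (liftf X) (liftf Y) (p, q) = warped_covd X Y p q.
Proof.
move=> oU1 oU2 Up Uq [sX1 sX2] [sY1 sY2].
(* Every tangent vector is tested by a lift of coordinate fields, which are smooth over the chart
   domains only. *)
set V1 := U1 `&` cdom (chart_at p); set V2 := U2 `&` cdom (chart_at q).
have oV1 : open V1 by apply: openI => //; exact: atlas_open (chart_at_atlas p).
have oV2 : open V2 by apply: openI => //; exact: atlas_open (chart_at_atlas q).
have Vp : V1 p by split=> //; exact: chart_at_dom.
have Vq : V2 q by split=> //; exact: chart_at_dom.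
have s1 X1 : smooth_vf U1 X1 -> smooth_vf V1 X1.
  by apply: smooth_vf_sub => ? [].
have s2 X2 : smooth_vf U2 X2 -> smooth_vf V2 X2.
  by apply: smooth_vf_sub => ? [].
have ip := warped_ip (p, q).
apply/eqP; rewrite -subr_eq0; apply/eqP; apply: (ip_inj ip) => w.
rewrite (bilin0l ip) -(hsubmxK w).
have := @warped_covd_test V1 V2 oV1 oV2 X Y
  (coord_vf p (lsubmx w), coord_vf q (rsubmx w)) p q Vp Vq.
rewrite /lift /= !coord_vf_at; apply.
- by split; [exact: s1|exact: s2].
- by split; [exact: s1|exact: s2].
split=> /=.
  by apply: smooth_vf_sub (smooth_coord_vf _ _) => ? [].
by apply: smooth_vf_sub (smooth_coord_vf _ _) => ? [].
Qed.

(** * Second covariant derivatives and curvature of lifts *)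

Section curvature_of_lifts.
Context (U1 : set M1) (U2 : set M2) (oU1 : open U1) (oU2 : open U2).
Local Notation U := (U1 `*` U2 : set MM).
Let oU : open U := open_prod oU1 oU2.
Let slam1 : smooth_fun U1 lam.
Proof. exact: smooth_fun_sub lam_smooth. Qed.
Let slam : smooth_fun U (fun x : MM => lam x.1).
Proof. exact: smooth_fst. Qed.
Let sgrad : smooth_vf U1 grad_lam.
Proof. exact: smooth_grad. Qed.
Let lam_neq0 p : lam p != 0.
Proof. exact: lt0r_neq0. Qed.

Let dlog (X1 : M1 -> 'rV[R]_m1) p := ddir p (X1 p) lam / lam p.

Let smooth_dlog X1 : smooth_vf U1 X1 -> smooth_fun U1 (dlog X1).
Proof.
move=> sX; apply: (smooth_funM oU1 (smooth_ddir oU1 sX slam1)).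
exact: smooth_funV.
Qed.

Let ddir_dlog X1 p v : U1 p -> smooth_vf U1 X1 ->
  ddir p v (dlog X1) = ddir p v (fun p => ddir p (X1 p) lam) / lam p -
    ddir p (X1 p) lam * ddir p v lam / lam p ^+ 2.
Proof.
move=> Up sX; have sV : smooth_fun U1 (fun p => (lam p)^-1).
  exact: smooth_funV.
rewrite (ddirM _ (smooth_ddir oU1 sX slam1) sV Up).
rewrite (ddirV _ slam1 Up (lam_neq0 p)).
have := lam_neq0 p; move: (lam p) (ddir p v lam) (ddir p (X1 p) lam).
by move: (ddir p v _) => a l b c l0; field.
Qed.

(** A combination of lifts whose coefficients are functions on the product: the form to which the
    Leibniz rule for an outer derivative applies. *)
Lemma covd_lift_expand (Y Z : field) x : U x ->
    smooth_pair U1 U2 Y -> smooth_pair U1 U2 Z ->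
  D (liftf Y) (liftf Z) x =
  lift (D1 Y.1 Z.1) (D2 Y.2 Z.2) x
    - (lam x.1 * g2 x.2 (Y.2 x.2) (Z.2 x.2)) *: lift grad_lam (fun=> 0) x
    + dlog Y.1 x.1 *: lift (fun=> 0) Z.2 x
    + dlog Z.1 x.1 *: lift (fun=> 0) Y.2 x.
Proof.
case: x => p q [/= Up Uq] sY sZ; rewrite (warped_covdE oU1 oU2 Up Uq sY sZ).
rewrite /warped_covd /lift /dlog /=.
move: (D1 _ _ p) (grad_lam p) => a b; move: (D2 _ _ q) (Z.2 q) (Y.2 q) => c d e.
rewrite !scale_row_mx opp_row_mx !add_row_mx.
by congr row_mx; apply/rowP => i; rewrite !mxE; ring.
Qed.

Lemma covd2_lift (X Y Z : field) p q : U1 p -> U2 q ->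
    smooth_pair U1 U2 X -> smooth_pair U1 U2 Y -> smooth_pair U1 U2 Z ->
  D (liftf X) (D (liftf Y) (liftf Z)) (p, q) =
  warped_covd X (D1 Y.1 Z.1, D2 Y.2 Z.2) p q
  - ((lam p * (g2 q (D2 X.2 Y.2 q) (Z.2 q) + g2 q (Y.2 q) (D2 X.2 Z.2 q))
      + g2 q (Y.2 q) (Z.2 q) * ddir p (X.1 p) lam) *: row_mx (grad_lam p) 0
     + (lam p * g2 q (Y.2 q) (Z.2 q)) *: row_mx (D1 X.1 grad_lam p)
         ((g1 p (grad_lam p) (grad_lam p) / lam p) *: X.2 q))
  + (ddir p (X.1 p) (dlog Y.1) *: row_mx 0 (Z.2 q)
     + dlog Y.1 p *: row_mx (- (lam p * g2 q (X.2 q) (Z.2 q)) *: grad_lam p)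
         (D2 X.2 Z.2 q + dlog X.1 p *: Z.2 q))
  + (ddir p (X.1 p) (dlog Z.1) *: row_mx 0 (Y.2 q)
     + dlog Z.1 p *: row_mx (- (lam p * g2 q (X.2 q) (Y.2 q)) *: grad_lam p)
         (D2 X.2 Y.2 q + dlog X.1 p *: Y.2 q)).
Proof.
move=> Up Uq sX sY sZ; have Ux : U (p, q) by [].
have [[sX1 sX2] [sY1 sY2] [sZ1 sZ2]] := And3 sX sY sZ.
have hC := covdP D; have sXb := smooth_lift oU1 oU2 sX1 sX2.
have sYZ := connection_smooth hC oU (smooth_lift oU1 oU2 sY1 sY2)
  (smooth_lift oU1 oU2 sZ1 sZ2).
have sDYZ : smooth_pair U1 U2 (D1 Y.1 Z.1, D2 Y.2 Z.2).
  split; first exact (connection_smooth (covdP D1) oU1 sY1 sZ1).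
  exact (connection_smooth (covdP D2) oU2 sY2 sZ2).
have s01 := smooth_vf0 (M := M1) oU1; have s02 := smooth_vf0 (M := M2) oU2.
have sg : smooth_pair U1 U2 (grad_lam, fun=> 0).
  exact (conj sgrad s02).
have s0 V2 : smooth_vf U2 V2 -> smooth_pair U1 U2 (fun=> 0, V2).
  by move=> sV2; exact (conj s01 sV2).
have sh := metric_smooth hg2 oU2 sY2 sZ2.
have sh' := smooth_snd oU1 oU2 sh.
have sphi := smooth_funM oU slam sh'.
have sdY := smooth_fst oU1 oU2 (smooth_dlog sY1).
have sdZ := smooth_fst oU1 oU2 (smooth_dlog sZ1).
have sT0 := smooth_lift oU1 oU2 sDYZ.1 sDYZ.2.
have sG := smooth_lift oU1 oU2 sgrad s02.
have sT1 := smooth_vfZ oU sphi sG.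
have sZ0 := smooth_lift oU1 oU2 s01 sZ2; have sY0 := smooth_lift oU1 oU2 s01 sY2.
have sT2 := smooth_vfZ oU sdY sZ0; have sT3 := smooth_vfZ oU sdZ sY0.
have sT01 := smooth_vfB oU sT0 sT1; have sT012 := smooth_vfD oU sT01 sT2.
have E0 := warped_covdE oU1 oU2 Up Uq sX sDYZ.
(* The squared length of the gradient arises here, as the derivative of [lam] along its own
   gradient. *)
have E1 : D (liftf X) (lift grad_lam (fun=> 0)) (p, q) =
    row_mx (D1 X.1 grad_lam p)
      ((g1 p (grad_lam p) (grad_lam p) / lam p) *: X.2 q).
  refine (etrans (warped_covdE oU1 oU2 Up Uq sX sg) _); rewrite /warped_covd /=.
  rewrite (nabla0r D2 oU2 Uq sX2) (bilin0r (ip2 q)) (gradP hg1 _ oU1 slam1 Up).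
  rewrite mulr0; move: (D1 _ _ p) (grad_lam p) => a b; move: (ddir p _ lam) => e.
  move: (X.2 q) (ddir p _ lam) => c d.
  by congr row_mx; apply/rowP => i; rewrite !mxE; ring.
have E2 V2 : smooth_vf U2 V2 -> D (liftf X) (lift (fun=> 0) V2) (p, q) =
    row_mx (- (lam p * g2 q (X.2 q) (V2 q)) *: grad_lam p)
      (D2 X.2 V2 q + dlog X.1 p *: V2 q).
  move=> sV2; refine (etrans (warped_covdE oU1 oU2 Up Uq sX (s0 _ sV2)) _).
  have dl0 : ddir p 0 lam = 0 by exact: derive0.
  rewrite /warped_covd /= (nabla0r D1 oU1 Up sX1) dl0 mul0r /dlog.
  move: (grad_lam p) (ddir p _ lam) => a b; move: (D2 _ _ q) (V2 q) (X.2 q) => c d e.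
  move: (g2 q _ _) => h.
  by congr row_mx; apply/rowP => i; rewrite !mxE; ring.
have F1 : ddir ((p, q) : MM) (liftf X (p, q))
      (fun x : MM => lam x.1 * g2 x.2 (Y.2 x.2) (Z.2 x.2)) =
    lam p * (g2 q (D2 X.2 Y.2 q) (Z.2 q) + g2 q (Y.2 q) (D2 X.2 Z.2 q)) +
    g2 q (Y.2 q) (Z.2 q) * ddir p (X.1 p) lam.
  rewrite (ddirM _ slam sh' Ux) /lift /=.
  rewrite (ddir_snd _ _ _ _ (fun q => g2 q (Y.2 q) (Z.2 q))) ddir_fst.
  by rewrite (levi_civita_metric hD2 oU2 sX2 sY2 sZ2 Uq).
have L1 := connection_leibniz hC oU sphi sXb sG Ux.
have L2 := connection_leibniz hC oU sdY sXb sZ0 Ux.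
have L3 := connection_leibniz hC oU sdZ sXb sY0 Ux.
rewrite F1 E1 in L1; rewrite (E2 _ sZ2) ddir_fst in L2.
rewrite (E2 _ sY2) ddir_fst in L3.
(* The expansion holds on all of [U], so locality allows it under the outer derivative. *)
rewrite (nabla_extr D oU Ux (fun x Ux => covd_lift_expand Ux sY sZ) sXb sYZ).
refine (etrans (connectionDr hC oU sXb sT012 sT3 Ux) _).
refine (etrans (congr1 (fun v => v + _) (connectionDr hC oU sXb sT01 sT2 Ux)) _).
by rewrite (nablaBr D oU Ux sXb sT0 sT1) E0 L1 L2 L3.
Qed.

Lemma curv_lift (X Y Z : field) p q : U1 p -> U2 q ->
    smooth_pair U1 U2 X -> smooth_pair U1 U2 Y -> smooth_pair U1 U2 Z ->
  curv D (liftf X) (liftf Y) (liftf Z) (p, q) =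
  row_mx
    (curv D1 X.1 Y.1 Z.1 p
      - (lam p * g2 q (Y.2 q) (Z.2 q)) *: D1 X.1 grad_lam p
      + (lam p * g2 q (X.2 q) (Z.2 q)) *: D1 Y.1 grad_lam p)
    (curv D2 X.2 Y.2 Z.2 q
      + (g1 p (D1 X.1 grad_lam p) (Z.1 p) / lam p
         + g1 p (grad_lam p) (grad_lam p) * g2 q (X.2 q) (Z.2 q)) *: Y.2 q
      - (g1 p (D1 Y.1 grad_lam p) (Z.1 p) / lam p
         + g1 p (grad_lam p) (grad_lam p) * g2 q (Y.2 q) (Z.2 q)) *: X.2 q).
Proof.
move=> Up Uq sX sY sZ; have Ux : U (p, q) by [].
have [[sX1 sX2] [sY1 sY2] [sZ1 sZ2]] := And3 sX sY sZ.
have sB1 := smooth_bracket (levi_civita_torsion hD1) oU1 sX1 sY1.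
have sB2 := smooth_bracket (levi_civita_torsion hD2) oU2 sX2 sY2.
have sB : smooth_pair U1 U2 (bracket X.1 Y.1, bracket X.2 Y.2).
  exact (conj sB1 sB2).
have sBb := smooth_bracket (levi_civita_torsion hD) oU
  (smooth_lift oU1 oU2 sX1 sX2) (smooth_lift oU1 oU2 sY1 sY2).
have C1 := covd2_lift Up Uq sX sY sZ; have C2 := covd2_lift Up Uq sY sX sZ.
have C3 : D (bracket (liftf X) (liftf Y)) (liftf Z) (p, q) =
    warped_covd (bracket X.1 Y.1, bracket X.2 Y.2) Z p q.
  rewrite -(warped_covdE oU1 oU2 Up Uq sB sZ).
  apply: (nabla_extl D oU Ux _ sBb (smooth_lift oU1 oU2 sZ1 sZ2)) => -[p' q'].
  by move=> [Up' Uq']; exact (bracket_lift oU1 oU2 Up' Uq' sX1 sY1 sX2 sY2).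
(* [T2] and [BL] express the values of the brackets through quantities already present in [C1] and
   [C2]. The terms [D1 B1] and [D2 B2] below stay opaque, since they belong to the curvatures of the
   factors. *)
have T2 := levi_civita_torsion hD2 oU2 sX2 sY2 Uq.
have BL := ddir_bracket oU1 Up sX1 sY1 slam1.
rewrite /warped_covd /= BL -T2 (bilinDl (ip2 q)) (bilinNl (ip2 q)) in C1 C2 C3.
rewrite (ip_sym (ip2 q) (Y.2 q) (X.2 q)) in C2.
rewrite !(ddir_dlog _ Up)// in C1 C2.
rewrite /dlog in C1 C2.
(* The other side contains second derivatives of [lam] coming from [dlog], so the Hessians are
   expanded to match them. *)
rewrite (nabla_grad hg1 hD1 oU1 Up slam1 sX1 sZ1).
rewrite (nabla_grad hg1 hD1 oU1 Up slam1 sY1 sZ1).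
rewrite /curv C1 C2 C3 {C1 C2 C3 BL T2}.
move: sB1 sB2 sB sBb => _ _ _ _.
move: (bracket X.1 Y.1) (bracket X.2 Y.2) => B1 B2.
have := lam_neq0 p.
move: (g1 p (grad_lam p) (grad_lam p)) => N.
move: (ddir p (X.1 p) lam) (ddir p (Y.1 p) lam) (ddir p (Z.1 p) lam) => lx ly lz.
move: (ddir p (X.1 p) (fun p => ddir p (Y.1 p) lam)).
move: (ddir p (X.1 p) (fun p => ddir p (Z.1 p) lam)).
move: (ddir p (Y.1 p) (fun p => ddir p (X.1 p) lam)).
move: (ddir p (Y.1 p) (fun p => ddir p (Z.1 p) lam)).
move: (ddir p (D1 X.1 Z.1 p) lam) (ddir p (D1 Y.1 Z.1 p) lam).
move: (D1 X.1 (D1 Y.1 Z.1) p) (D1 Y.1 (D1 X.1 Z.1) p) (D1 B1 Z.1 p).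
move: (D2 X.2 (D2 Y.2 Z.2) q) (D2 Y.2 (D2 X.2 Z.2) q) (D2 B2 Z.2 q).
move: (D1 X.1 grad_lam p) (D1 Y.1 grad_lam p) (grad_lam p).
move: (D2 X.2 Y.2 q) (D2 Y.2 X.2 q) (D2 X.2 Z.2 q) (D2 Y.2 Z.2 q).
move: (X.2 q) (Y.2 q) (Z.2 q) (lam p).
move=> x2 y2 z2 l dxy dyx dxz dyz gx gy g a1 a2 a3 b1 b2 b3 c1 c2 yz yx xz xy l0.
move: (g2 q) => G.
rewrite !scale_row_mx; do 3![rewrite ?opp_row_mx ?add_row_mx].
by congr row_mx; apply/rowP => i; rewrite !mxE; field.
Qed.

End curvature_of_lifts.

Let tf1 := levi_civita_torsion hD1.
Let tf2 := levi_civita_torsion hD2.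
Let tf := levi_civita_torsion hD.
Local Notation Hess1 := (Hess g1 D1 lam).
Local Notation norm2 p := (vnorm g1 p (grad_lam p) ^+ 2).

Lemma vnorm_sqr p v : vnorm g1 p v ^+ 2 = g1 p v v.
Proof.
rewrite /vnorm sqr_sqrtr//; have [->|v0] := eqVneq v 0.
  by rewrite (bilin0l (ip1 p)).
exact: ltW (ip_pos (ip1 p) v0).
Qed.

Lemma Hess_lam_sym p u v : Hess1 p u v = Hess1 p v u.
Proof. exact (Hess_sym hg1 hD1 u v openT (I : [set: M1] p) lam_smooth). Qed.

Lemma Hess0r p v : Hess1 p v 0 = 0.
Proof. exact: bilin0r (ip1 p) _. Qed.

(** The first slot of [Hess] sits inside a covariant derivative; symmetry moves the zero to the
    second, a slot of the metric. *)
Lemma Hess0l p v : Hess1 p 0 v = 0.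
Proof. by rewrite Hess_lam_sym Hess0r. Qed.

Lemma warped_Rm_at p q (w1 z1 x1 y1 : 'rV[R]_m1) (w2 z2 x2 y2 : 'rV[R]_m2) :
  Rm_at gw D ((p, q) : MM)
    (row_mx w1 w2) (row_mx z1 z2) (row_mx x1 x2) (row_mx y1 y2) =
  Rm_at g1 D1 p w1 z1 x1 y1 + lam p ^+ 2 * Rm_at g2 D2 q w2 z2 x2 y2
  + lam p * Hess1 p y1 w1 * g2 q x2 z2 - lam p * Hess1 p x1 w1 * g2 q y2 z2
  + lam p * Hess1 p x1 z1 * g2 q w2 y2 - lam p * Hess1 p y1 z1 * g2 q w2 x2
  + lam p ^+ 2 * norm2 p * g2 q x2 z2 * g2 q w2 y2
  - lam p ^+ 2 * norm2 p * g2 q y2 z2 * g2 q w2 x2.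
Proof.
have oU1 := atlas_open (chart_at_atlas p).
have oU2 := atlas_open (chart_at_atlas q).
have [cp cq] := (chart_at_dom p, chart_at_dom q).
pose E (v1 : 'rV[R]_m1) (v2 : 'rV[R]_m2) : field := (coord_vf p v1, coord_vf q v2).
have sE v1 v2 : smooth_pair (cdom (chart_at p)) (cdom (chart_at q)) (E v1 v2).
  exact (conj (smooth_coord_vf p v1) (smooth_coord_vf q v2)).
have sL v1 v2 : smooth_vf (cdom (chart_at p) `*` cdom (chart_at q) : set MM)
    (liftf (E v1 v2)).
  exact (smooth_lift oU1 oU2 (smooth_coord_vf p v1) (smooth_coord_vf q v2)).
have LE v1 v2 : liftf (E v1 v2) (p, q) = row_mx v1 v2.
  by rewrite /lift /= !coord_vf_at.
have C := curv_lift oU1 oU2 cp cq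
  (sE x1 x2) (sE y1 y2) (sE z1 z2).
(* [Rm_at] extends vectors by coordinate fields of the product chart, [curv_lift] is about lifts; as
   the values at [(p, q)] agree, tensoriality identifies the two curvatures. *)
have C' := curvE tf (open_prod oU1 oU2) (conj cp cq : _ (p, q))
  (sL x1 x2) (sL y1 y2) (sL z1 z2).
have C'' := etrans (esym (etrans C'
  (f_equal3 (curv_at D (p, q)) (LE x1 x2) (LE y1 y2) (LE z1 z2)))) C.
rewrite !Rm_atE C'' warpedE vnorm_sqr /Hess /E /= !coord_vf_at.
rewrite /curv_at.
move: (curv D1 _ _ _ p) (curv D2 _ _ _ q) => c1 c2.
move: (coord_vf p x1) (coord_vf p y1) => X1 Y1.
move: (D1 X1 grad_lam p) (D1 Y1 grad_lam p) => hx hy.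
move: (g1 p (grad_lam p) (grad_lam p)) => N.
rewrite (bilinDr (ip1 p)) (bilinDr (ip1 p)) (bilinNr (ip1 p)).
rewrite !(bilinZr (ip1 p)) !(bilinDr (ip2 q)) (bilinNr (ip2 q)).
rewrite !(bilinZr (ip2 q)) (ip_sym (ip1 p) w1 hx) (ip_sym (ip1 p) w1 hy).
have := lt0r_neq0 (lam_gt0 p); move: (lam p) => l l0.
by field.
Qed.

(** * Traces along adapted frames *)

Section frames.
Context (p : M1) (q : M2) (e1 : 'I_m1 -> 'rV[R]_m1) (e2 : 'I_m2 -> 'rV[R]_m2).
Hypotheses (oe1 : orthonormal (g1 p) e1) (oe2 : orthonormal (g2 q) e2).

Definition warped_frame (i : 'I_(m1 + m2)) : 'rV[R]_(m1 + m2) :=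
  match fintype.split i with
  | inl i1 => row_mx (e1 i1) 0
  | inr i2 => row_mx 0 ((lam p)^-1 *: e2 i2)
  end.

Lemma warped_frame_lshift i : warped_frame (lshift m2 i) = row_mx (e1 i) 0.
Proof. by rewrite /warped_frame (unsplitK (inl i)). Qed.

Lemma warped_frame_rshift i :
  warped_frame (rshift m1 i) = row_mx 0 ((lam p)^-1 *: e2 i).
Proof. by rewrite /warped_frame (unsplitK (inr i)). Qed.

Let unit2 j : g2 q (e2 j) (e2 j) = 1.
Proof. by rewrite oe2 eqxx. Qed.

Lemma warped_frame_orthonormal : orthonormal (gw (p, q)) warped_frame.
Proof.
have l0 := lt0r_neq0 (lam_gt0 p).
move=> i j; rewrite -(splitK i) -(splitK j).
case: (fintype.split i) => i'; case: (fintype.split j) => j' /=;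
  rewrite ?warped_frame_lshift ?warped_frame_rshift warpedE.
- by rewrite (bilin0l (ip2 q)) mulr0 addr0 oe1 eq_lshift.
- by rewrite (bilin0l (ip2 q)) (bilin0r (ip1 p)) mulr0 addr0 eq_lrshift.
- by rewrite (bilin0r (ip2 q)) (bilin0l (ip1 p)) mulr0 addr0 eq_rlshift.
rewrite (bilin0l (ip1 p)) (bilinZl (ip2 q)) (bilinZr (ip2 q)) oe2 eq_rshift.
by move: (_ %:R) => b; field.
Qed.

Lemma warped_trace (e : 'I_(m1 + m2) -> 'rV[R]_(m1 + m2)) T :
    orthonormal (gw (p, q)) e -> bilinear_form T ->
  \sum_i T (e i) (e i) =
  \sum_i T (row_mx (e1 i) 0) (row_mx (e1 i) 0) +
  \sum_j T (row_mx 0 ((lam p)^-1 *: e2 j)) (row_mx 0 ((lam p)^-1 *: e2 j)).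
Proof.
move=> oe hT.
rewrite (trace_orthonormal (warped_ip (p, q)) oe warped_frame_orthonormal hT).
rewrite big_split_ord; congr (_ + _); apply: eq_bigr => i _.
  by rewrite warped_frame_lshift.
by rewrite warped_frame_rshift.
Qed.

(** Horizontal vectors contribute the Laplacian. Among the vertical ones, [m2] equal terms are
    subtracted and [parseval] gives one copy of the gradient term back, whence the factor
    [m2 - 1]. *)
Lemma warped_Ric (e : 'I_(m1 + m2) -> 'rV[R]_(m1 + m2)) x1 y1 x2 y2 :
    orthonormal (gw (p, q)) e ->
  Ric gw D ((p, q) : MM) e (row_mx x1 x2) (row_mx y1 y2) =
  Ric g1 D1 p e1 x1 y1 + Ric g2 D2 q e2 x2 y2
  - lam p * g2 q x2 y2 * laplacian g1 D1 lam p e1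
  - m2%:R / lam p * Hess1 p x1 y1
  - (m2%:R - 1) * norm2 p * g2 q x2 y2.
Proof.
move=> oe; have l0 := lt0r_neq0 (lam_gt0 p).
have Z1 := bilin0l (Rm_at_bilin13 tf1 (ip1 p) x1 y1) 0.
have Z2 := bilin0l (Rm_at_bilin13 tf2 (ip2 q) x2 y2) 0.
have S2 j : Rm_at g2 D2 q ((lam p)^-1 *: e2 j) x2 ((lam p)^-1 *: e2 j) y2 =
    (lam p)^-1 * ((lam p)^-1 * Rm_at g2 D2 q (e2 j) x2 (e2 j) y2).
  have B2 := Rm_at_bilin13 tf2 (ip2 q) x2 y2.
  exact: etrans (bilinZl B2 _ _ _) (congr1 _ (bilinZr B2 _ _ _)).
have G0 v : g2 q 0 v = 0 by exact: bilin0l (ip2 q) v.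
have horizontal i : Rm_at gw D ((p, q) : MM) (row_mx (e1 i) 0) (row_mx x1 x2)
    (row_mx (e1 i) 0) (row_mx y1 y2) =
    Rm_at g1 D1 p (e1 i) x1 (e1 i) y1
    - lam p * g2 q x2 y2 * Hess1 p (e1 i) (e1 i).
  rewrite warped_Rm_at Z2 !G0 (ip_sym (ip2 q) y2).
  have drop0 (a l h k c d n s : R) : a + l ^+ 2 * 0 + c * 0 - l * h * k + d * 0
      - s * 0 + n * 0 * 0 - n * k * 0 = a - l * k * h by ring.
  exact: drop0.
have vertical j : Rm_at gw D ((p, q) : MM) (row_mx 0 ((lam p)^-1 *: e2 j))
    (row_mx x1 x2) (row_mx 0 ((lam p)^-1 *: e2 j)) (row_mx y1 y2) =
    Rm_at g2 D2 q (e2 j) x2 (e2 j) y2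
    + norm2 p * (g2 q (e2 j) x2 * g2 q (e2 j) y2)
    - (Hess1 p x1 y1 / lam p + norm2 p * g2 q x2 y2).
  rewrite warped_Rm_at Z1 S2 !Hess0r Hess0l (Hess_lam_sym p y1).
  rewrite !(bilinZl (ip2 q)) !(bilinZr (ip2 q)) unit2 (ip_sym (ip2 q) y2).
  move: (Rm_at _ _ _ _ _ _ _) (Hess _ _ _ _ _ _) (vnorm _ _ _) => a b n.
  by move: (lam p) l0 => l l0; field.
refine (etrans (warped_trace oe (Rm_at_bilin13 tf (warped_ip (p, q)) _ _)) _).
rewrite (eq_bigr _ (fun i _ => horizontal i)) (eq_bigr _ (fun j _ => vertical j)).
rewrite !sumrB big_split -!mulr_sumr -(parseval _ _ (ip2 q) oe2).
rewrite sumr_const card_ord -[_ *+ m2]mulr_natl /Ric /laplacian /=.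
move: (\sum_i _) (\sum_i _) (\sum_i _) (Hess _ _ _ _ _ _) => a b c h.
by move: (vnorm _ _ _) (g2 q x2 y2) (lam p) l0 => n k l l0; field.
Qed.

(** The Laplacian occurs [m2] times from the trace of the Hessian over horizontal vectors and once
    for each of the [m2] vertical ones, whence the factor 2. *)
Lemma warped_Scal (e : 'I_(m1 + m2) -> 'rV[R]_(m1 + m2)) :
    orthonormal (gw (p, q)) e ->
  Scal gw D ((p, q) : MM) e =
  Scal g1 D1 p e1 + (lam p ^+ 2)^-1 * Scal g2 D2 q e2
  - 2 * m2%:R / lam p * laplacian g1 D1 lam p e1
  - m2%:R * (m2%:R - 1) / lam p ^+ 2 * norm2 p.
Proof.
move=> oe; have l0 := lt0r_neq0 (lam_gt0 p).
have B1 := Ric_bilin tf1 (ip1 p) e1; have B2 := Ric_bilin tf2 (ip2 q) e2.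
have horizontal i : Ric gw D ((p, q) : MM) e (row_mx (e1 i) 0) (row_mx (e1 i) 0) =
    Ric g1 D1 p e1 (e1 i) (e1 i) - m2%:R / lam p * Hess1 p (e1 i) (e1 i).
  rewrite (warped_Ric _ _ _ _ oe) (bilin0l B2) (bilin0l (ip2 q)).
  by rewrite !mulr0 mul0r !subr0 addr0.
have vertical j : Ric gw D ((p, q) : MM) e (row_mx 0 ((lam p)^-1 *: e2 j))
    (row_mx 0 ((lam p)^-1 *: e2 j)) =
    (lam p ^+ 2)^-1 * Ric g2 D2 q e2 (e2 j) (e2 j) -
    (laplacian g1 D1 lam p e1 / lam p + (m2%:R - 1) / lam p ^+ 2 * norm2 p).
  rewrite (warped_Ric _ _ _ _ oe) (bilin0l B1) Hess0l (bilinZl B2) (bilinZr B2).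
  rewrite (bilinZl (ip2 q)) (bilinZr (ip2 q)) unit2.
  move: (Ric _ _ _ _ _ _) (laplacian _ _ _ _ _) (vnorm _ _ _) => a b n.
  by move: (lam p) l0 => l l0; field.
refine (etrans (warped_trace oe (Ric_bilin tf (warped_ip (p, q)) e)) _).
rewrite (eq_bigr _ (fun i _ => horizontal i)) (eq_bigr _ (fun j _ => vertical j)).
rewrite !sumrB -!mulr_sumr sumr_const card_ord -[_ *+ m2]mulr_natl.
rewrite -/(Scal g1 D1 p e1) -/(Scal g2 D2 q e2) -/(laplacian g1 D1 lam p e1).
move: (Scal _ _ _ _) (Scal _ _ _ _) (laplacian _ _ _ _ _) (vnorm _ _ _).
by move: (lam p) l0 => l l0 a b c n; field.
Qed.

End frames.

End warped_product.

Theorem theorem2p9 (R : realType) (m1 m2 : nat)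
    (M1 : manifold R m1) (M2 : manifold R m2)
    (g1 : metric M1) (g2 : metric M2) (lam : M1 -> R)
    (D1 : (M1 -> 'rV[R]_m1) -> (M1 -> 'rV[R]_m1) -> M1 -> 'rV[R]_m1)
    (D2 : (M2 -> 'rV[R]_m2) -> (M2 -> 'rV[R]_m2) -> M2 -> 'rV[R]_m2)
    (D : (prod_manifold M1 M2 -> 'rV[R]_(m1 + m2)) ->
         (prod_manifold M1 M2 -> 'rV[R]_(m1 + m2)) ->
         prod_manifold M1 M2 -> 'rV[R]_(m1 + m2))
    (hm2 : (2 <= m2)%N)
    (hg1 : riemannian g1) (hg2 : riemannian g2)
    (lam_smooth : smooth_fun setT lam) (lam_gt0 : forall p, 0 < lam p)
    (hD1 : levi_civita g1 D1) (hD2 : levi_civita g2 D2)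
    (hD : levi_civita (warped g1 g2 lam) D) :
  [/\ forall (W1 Z1 X1 Y1 : prod_manifold M1 M2 -> 'rV[R]_m1)
             (W2 Z2 X2 Y2 : prod_manifold M1 M2 -> 'rV[R]_m2),
        smooth_vf setT (vf_pair W1 W2) -> smooth_vf setT (vf_pair Z1 Z2) ->
        smooth_vf setT (vf_pair X1 X2) -> smooth_vf setT (vf_pair Y1 Y2) ->
        forall (p : M1) (q : M2), let x : prod_manifold M1 M2 := (p, q) in
        Rm (warped g1 g2 lam) D (vf_pair W1 W2) (vf_pair Z1 Z2)
           (vf_pair X1 X2) (vf_pair Y1 Y2) x =
          Rm_at g1 D1 p (W1 x) (Z1 x) (X1 x) (Y1 x)
          + lam p ^+ 2 * Rm_at g2 D2 q (W2 x) (Z2 x) (X2 x) (Y2 x)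
          + lam p * Hess g1 D1 lam p (Y1 x) (W1 x) * g2 q (X2 x) (Z2 x)
          - lam p * Hess g1 D1 lam p (X1 x) (W1 x) * g2 q (Y2 x) (Z2 x)
          + lam p * Hess g1 D1 lam p (X1 x) (Z1 x) * g2 q (W2 x) (Y2 x)
          - lam p * Hess g1 D1 lam p (Y1 x) (Z1 x) * g2 q (W2 x) (X2 x)
          + lam p ^+ 2 * vnorm g1 p (grad g1 lam p) ^+ 2
            * g2 q (X2 x) (Z2 x) * g2 q (W2 x) (Y2 x)
          - lam p ^+ 2 * vnorm g1 p (grad g1 lam p) ^+ 2
            * g2 q (Y2 x) (Z2 x) * g2 q (W2 x) (X2 x),
      forall (X1 Y1 : prod_manifold M1 M2 -> 'rV[R]_m1)
             (X2 Y2 : prod_manifold M1 M2 -> 'rV[R]_m2),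
        smooth_vf setT (vf_pair X1 X2) -> smooth_vf setT (vf_pair Y1 Y2) ->
        forall (p : M1) (q : M2), let x : prod_manifold M1 M2 := (p, q) in
        forall (e1 : 'I_m1 -> 'rV[R]_m1) (e2 : 'I_m2 -> 'rV[R]_m2)
               (e : 'I_(m1 + m2) -> 'rV[R]_(m1 + m2)),
        orthonormal_basis g1 p e1 -> orthonormal_basis g2 q e2 ->
        orthonormal_basis (warped g1 g2 lam) x e ->
        Ric (warped g1 g2 lam) D x e (vf_pair X1 X2 x) (vf_pair Y1 Y2 x) =
          Ric g1 D1 p e1 (X1 x) (Y1 x) + Ric g2 D2 q e2 (X2 x) (Y2 x)
          - lam p * g2 q (X2 x) (Y2 x) * laplacian g1 D1 lam p e1
          - m2%:R / lam p * Hess g1 D1 lam p (X1 x) (Y1 x)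
          - (m2%:R - 1) * vnorm g1 p (grad g1 lam p) ^+ 2
            * g2 q (X2 x) (Y2 x)
    & forall (p : M1) (q : M2), let x : prod_manifold M1 M2 := (p, q) in
        forall (e1 : 'I_m1 -> 'rV[R]_m1) (e2 : 'I_m2 -> 'rV[R]_m2)
               (e : 'I_(m1 + m2) -> 'rV[R]_(m1 + m2)),
        orthonormal_basis g1 p e1 -> orthonormal_basis g2 q e2 ->
        orthonormal_basis (warped g1 g2 lam) x e ->
        Scal (warped g1 g2 lam) D x e =
          Scal g1 D1 p e1 + (lam p ^+ 2)^-1 * Scal g2 D2 q e2
          - 2 * m2%:R / lam p * laplacian g1 D1 lam p e1
          - m2%:R * (m2%:R - 1) / lam p ^+ 2
            * vnorm g1 p (grad g1 lam p) ^+ 2].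

Proof.
pose C1 := Affine (levi_civita_connection hD1).
pose C2 := Affine (levi_civita_connection hD2).
pose C := Affine (levi_civita_connection hD).
have hC1 : levi_civita g1 C1 by [].
have hC2 : levi_civita g2 C2 by [].
have hC : levi_civita (warped g1 g2 lam) C by [].
split=> [W1 Z1 X1 Y1 W2 Z2 X2 Y2 sW sZ sX sY p q x|X1 Y1 X2 Y2 _ _ p q x|p q x].
- have := warped_Rm_at hg1 hg2 lam_smooth lam_gt0 hC1 hC2 hC p q
    (W1 x) (Z1 x) (X1 x) (Y1 x) (W2 x) (Z2 x) (X2 x) (Y2 x).
  rewrite (Rm_atE _ C) => <-; rewrite /Rm; congr (warped g1 g2 lam _ _ _).
  (* The given fields need not be lifts; tensoriality reduces the claim to their values at [x]. *)
  exact (curvE (levi_civita_torsion hC) openT (I : [set: prod_manifold M1 M2] x)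
    sX sY sZ).
- move=> e1 e2 e oe1 oe2 oe.
  exact (warped_Ric hg1 hg2 lam_smooth lam_gt0 hC1 hC2 hC oe1 oe2 _ _ _ _ oe).
move=> e1 e2 e oe1 oe2 oe.
exact (warped_Scal hg1 hg2 lam_smooth lam_gt0 hC1 hC2 hC oe1 oe2 oe).
Qed.
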